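(* Let $T>0$, $d,e,\ell\in\mathbb{N}^*$, $\alpha,\beta\in\,]0,1[$ with $\alpha+\beta>1$ and $\alpha<\beta$, and let $w\in \mathrm{C}^{\beta\text{-H\''ol}}([0,T];\mathbb{R}^d)$. Let $S$ be a nonempty convex compact subset of $\mathrm{C}^{\alpha\text{-H\''ol}}([0,T];\mathbb{R}^e)$, and let $\Phi:[0,T]\times\mathbb{R}^e\to\mathcal{P}_{\mathrm{ck}}(M_{\ell,d}(\mathbb{R}))$ be continuous for the Hausdorff distance. Assume that there exists $R>0$ such that, for every $x\in S$, the multifunction $\Phi(\cdot,x(\cdot))$ belongs to $\mathrm{C}^{\alpha\text{-H\''ol}}([0,T];\mathcal{P}_{\mathrm{ck}}(M_{\ell,d}(\mathbb{R})))$ and satisfies $N_{\alpha,T}(\Phi(\cdot,x(\cdot)))\leqslant R$. Let $r$ be a real number such that $$r\geqslant\sup_{x\in S}\min\Bigl(\mathfrak{k}_{\ell d}\,\|\Phi(\cdot,x(\cdot))\|_{\alpha,T},\ \|\Phi(\cdot,x(\cdot))\|_{\alpha,T,\mathrm{Dem}}\Bigr),$$ and let $$\Phi_w: S\to \mathrm{C}^{\alpha\text{-H\''ol}}([0,T];\mathcal{P}_{\mathrm{ck}}(\mathbb{R}^\ell)),\qquad \Phi_w(x)(t)=J_{t,\alpha,r}(\Phi(\cdot,x(\cdot)),w),\quad t\in[0,T].$$ Let $\mathbb{B}:=\{\Phi_w(x) : x\in S\}$, let $\alpha'\in\,]0,\alpha[$, and let $\Psi:\mathrm{C}^{\alpha\text{-H\''ol}}([0,T];\mathcal{P}_{\mathrm{ck}}(\mathbb{R}^\ell))\rightrightarrows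 \mathrm{C}^{\alpha\text{-H\''ol}}([0,T];\mathbb{R}^e)$ be a multifunction such that $\Psi(F)\neq\emptyset$ for every $F\in\mathbb{B}$, and which satisfies the following conditions: 1. For every sequence $(F_n)_{n\in\mathbb{N}}$ of elements of $\mathbb{B}$ such that there exists $F\in\mathbb{B}$ satisfying $\mathrm{Ls}_{n\to\infty}F_n(t)\subset F(t)$ for all $t\in[0,T]$, if $\psi_n\in\Psi(F_n)$ converges in $\mathrm{C}^{\alpha'\text{-H\''ol}}([0,T];\mathbb{R}^e)$ to $\psi\in \mathrm{C}^{\alpha\text{-H\''ol}}([0,T];\mathbb{R}^e)$, then $\psi\in\Psi(F)$. 2. For every $F\in\mathbb{B}$, $\Psi(F)$ is convex, closed and contained in $S$. Then $\Gamma=\Psi\circ\Phi_w$ has at least one fixed point in $S$, i.e. there exists $x\in S$ such that $x\in\Psi(\Phi_w(x))$.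
   Context: $M_{\ell,d}(\mathbb{R})$ is the space of real $\ell\times d$ matrices, identified with $\mathbb{R}^{\ell d}$ with Euclidean norm $\|\cdot\|$. For $E=\mathbb{R}^m$, $\mathcal{P}_{\mathrm{ck}}(E)$ is the set of nonempty convex compact subsets of $E$, endowed with the Hausdorff distance $d_{\mathrm{H}}$ unless otherwise specified. $\|A\|_{d_{\mathrm{H}}}:=\sup_{a\in A}\|a\|$. Demyanov distance: for $C\in\mathcal{P}_{\mathrm{ck}}(E)$ and $l\in E$ let $Y(l,C)=\{c\in C:\langle l,c\rangle=\max_{x\in C}\langle l,x\rangle\}$; if $Y(l,C)$ is a singleton its element is denoted $y(l,C)$ and $l$ is called an exposing direction of $C$; $\mathcal{T}_C$ is the set of exposing directions of $C$. Then $d_{\mathrm{D}}(A,B)=\sup\{\|y(l,A)-y(l,B)\| : l\in\mathcal{T}_A\cap\mathcal{T}_B\}$. Steiner constant: the Steiner point of $C\in\mathcal{P}_{\mathrm{ck}}(\mathbb{R}^m)$ is $\mathrm{St}(C)=\frac1{v_m}\int_{\mathcal{T}_C\cap B(0,1)}y(x,C)\,dx$, where $B(0,1)$ is the unit ball of $\mathbb{R}^m$ and $v_m$ its volume. The map $\mathrm{St}:(\mathcal{P}_{\mathrm{ck}}(\mathbb{R}^m),d_{\mathrm{H}})\to\mathbb{R}^m$ is Lipschitz, and $\mathfrak{k}_m$ denotes its sharp (smallest) Lipschitz constant. Hölder spaces: for $F:[0,T]\to\mathcal{P}_{\mathrm{ck}}(E)$, $\|F\|_{\infty,T}=\sup_t\|F(t)\|_{d_{\mathrm{H}}}$,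 $\|F\|_{\alpha,T}=\sup_{s<t}d_{\mathrm{H}}(F(s),F(t))/|t-s|^\alpha$, $N_{\alpha,T}(F)=\|F\|_{\infty,T}+\|F\|_{\alpha,T}$, and $\|F\|_{\alpha,T,\mathrm{Dem}}\in[0,+\infty]$ is defined like $\|F\|_{\alpha,T}$ with $d_{\mathrm{D}}$ instead of $d_{\mathrm{H}}$. $\mathrm{C}^{\alpha\text{-H\''ol}}([0,T];\mathcal{P}_{\mathrm{ck}}(E))$ is the set of $F$ with $\|F\|_{\alpha,T}<\infty$. For point-valued functions (identified with singleton-valued multifunctions) the same notation is used, and $\mathrm{C}^{\alpha\text{-H\''ol}}([0,T];E)$ is equipped with the norm $N_{\alpha,T}$. Aumann–Young integral: for $F\in \mathrm{C}^{\alpha\text{-H\''ol}}([0,T];\mathcal{P}_{\mathrm{ck}}(M_{\ell,d}(\mathbb{R})))$, $\mathcal{S}_{\alpha,r}(F)$ is the set of measurable $f:[0,T]\to M_{\ell,d}(\mathbb{R})$ with $f(t)\in F(t)$ for all $t\in[0,T]$ and $\|f\|_{\alpha,T}\leqslant r$, and $J_{t,\alpha,r}(F,w)=\{\int_0^t f(s)\,dw(s) : f\in\mathcal{S}_{\alpha,r}(F)\}\subset\mathbb{R}^\ell$, where $\int_0^t f\,dw$ is the Young integral, i.e. the limit of Riemann sums $\sum_k f(t_k)(w(t_{k+1})-w(t_k))$ as the mesh of the dissection of $[0,t]$ tends to $0$. If $\alpha,\beta\in\,]0,1[$ satisfy $\alpha+\beta>1$ and $\alpha<\beta$, if $w\in\mathrm{C}^{\beta\text{-H\''ol}}([0,T];\mathbb{R}^d)$,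 if $S$ is a nonempty convex compact subset of $\mathrm{C}^{\alpha\text{-H\''ol}}([0,T];\mathbb{R}^e)$, if $\Phi:[0,T]\times\mathbb{R}^e\to\mathcal{P}_{\mathrm{ck}}(M_{\ell,d}(\mathbb{R}))$ is continuous for the Hausdorff distance and there exists $R>0$ such that $\Phi(\cdot,x(\cdot))\in\mathrm{C}^{\alpha\text{-H\''ol}}([0,T];\mathcal{P}_{\mathrm{ck}}(M_{\ell,d}(\mathbb{R})))$ and $N_{\alpha,T}(\Phi(\cdot,x(\cdot)))\leqslant R$ for every $x\in S$, and if $r\geqslant\sup_{x\in S}\min\bigl(\mathfrak{k}_{\ell d}\,\|\Phi(\cdot,x(\cdot))\|_{\alpha,T},\ \|\Phi(\cdot,x(\cdot))\|_{\alpha,T,\mathrm{Dem}}\bigr)$, then the map $\Phi_w: S\to \mathrm{C}^{\alpha\text{-H\''ol}}([0,T];\mathcal{P}_{\mathrm{ck}}(\mathbb{R}^\ell))$, $\Phi_w(x)(t)=J_{t,\alpha,r}(\Phi(\cdot,x(\cdot)),w)$, is well defined. $\mathrm{Ls}_{n\to\infty}A_n$ (Kuratowski upper limit) is the set of limits of sequences $(x_n)$ such that $x_n\in A_{m_n}$ for every $n$, for some subsequence $(A_{m_n})$ of $(A_n)$. *)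

(* Defs.v *)
From HB Require Import structures.
From mathcomp Require Import all_boot all_order all_algebra.
From mathcomp Require Import all_classical all_reals all_analysis.
From mathcomp Require Import ring lra.

Set Implicit Arguments.
Unset Strict Implicit.
Unset Printing Implicit Defensive.

Import Order.TTheory GRing.Theory Num.Theory.
Import numFieldNormedType.Exports.

Local Open Scope classical_set_scope.
Local Open Scope ring_scope.

Section Euclidean.
Context {R : realType} {p q : nat}.
Implicit Types A B : 'M[R]_(p, q).

Definition edot A B : R := \sum_i \sum_j A i j * B i j.

(* The norm `|A| of the library is the sup norm. It induces the same topology
   as [enorm], so that [compact] and convergence can be taken from the
   library, while every metric quantity below uses [enorm]. *)
Definition enorm A : R := Num.sqrt (edot A A).

Lemma edotDl A B C : edot (A + B) C = edot A C + edot B C.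
Proof.
rewrite /edot -big_split; apply: eq_bigr => i _; rewrite -big_split.
by apply: eq_bigr => j _; rewrite mxE mulrDl.
Qed.

Lemma edotC A B : edot A B = edot B A.
Proof. by apply: eq_bigr => i _; apply: eq_bigr => j _; rewrite mulrC. Qed.

Lemma edotZl k A B : edot (k *: A) B = k * edot A B.
Proof.
rewrite /edot mulr_sumr; apply: eq_bigr => i _; rewrite mulr_sumr.
by apply: eq_bigr => j _; rewrite mxE mulrA.
Qed.

Lemma edotDr A B C : edot C (A + B) = edot C A + edot C B.
Proof. by rewrite edotC edotDl !(edotC _ C). Qed.

Lemma edotZr k A B : edot B (k *: A) = k * edot B A.
Proof. by rewrite edotC edotZl edotC. Qed.

Lemma edot_ge0 A : 0 <= edot A A.
Proof. by apply: sumr_ge0 => i _; apply: sumr_ge0 => j _; rewrite -expr2 sqr_ge0. Qed.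

Lemma edot_eq0 A : edot A A = 0 -> A = 0.
Proof.
move/eqP; rewrite psumr_eq0 => [/allP A0|i _]; last first.
  by apply: sumr_ge0 => j _; rewrite -expr2 sqr_ge0.
apply/matrixP => i j; rewrite mxE; apply/eqP.
have := A0 i (mem_index_enum i); rewrite psumr_eq0 => [/allP Ai|k _].
  by have := Ai j (mem_index_enum j); rewrite -expr2 sqrf_eq0.
by rewrite -expr2 sqr_ge0.
Qed.

Lemma enorm_ge0 A : 0 <= enorm A. Proof. exact: sqrtr_ge0. Qed.

Lemma sqr_enorm A : enorm A ^+ 2 = edot A A.
Proof. by rewrite sqr_sqrtr// edot_ge0. Qed.

Lemma enorm0_eq0 A : enorm A = 0 -> A = 0.
Proof. by move=> A0; apply: edot_eq0; rewrite -sqr_enorm A0 expr0n. Qed.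

Lemma enormZ k A : enorm (k *: A) = `|k| * enorm A.
Proof.
by rewrite /enorm edotZl edotZr mulrA -expr2 sqrtrM ?sqr_ge0// sqrtr_sqr.
Qed.

Lemma enorm0 : enorm 0 = 0.
Proof. by rewrite -(scale0r 0) enormZ normr0 mul0r. Qed.

Lemma edot_le_enorm A B : edot A B <= enorm A * enorm B.
Proof.
have [/eqP/enorm0_eq0 ->|B0] := boolP (enorm B == 0).
  by rewrite enorm0 mulr0 -(scale0r 0) edotZr mul0r.
have [/eqP/enorm0_eq0 ->|A0] := boolP (enorm A == 0).
  by rewrite enorm0 mul0r -(scale0r 0) edotZl mul0r.
have a0 : 0 < enorm A by rewrite lt_def A0 enorm_ge0.
have b0 : 0 < enorm B by rewrite lt_def B0 enorm_ge0.
have := edot_ge0 (enorm B *: A + (- enorm A) *: B).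
rewrite !(edotDl, edotDr, edotZl, edotZr) -!sqr_enorm (edotC B A).
set a := enorm A; set b := enorm B; set c := edot A B.
rewrite [X in 0 <= X](_ : _ = 2 * (a * b) * (a * b - c)); last by ring.
by rewrite pmulr_rge0 ?mulr_gt0// subr_ge0.
Qed.

Lemma ler_enormD A B : enorm (A + B) <= enorm A + enorm B.
Proof.
rewrite -(@ler_pXn2r _ 2)// ?nnegrE ?addr_ge0 ?enorm_ge0//.
rewrite sqr_enorm !(edotDl, edotDr) sqrrD !sqr_enorm (edotC B A).
have := edot_le_enorm A B.
lra.
Qed.

End Euclidean.

Section Sets.
Context {R : realType} {p q : nat}.
Local Notation E := 'M[R]_(p, q).
Implicit Types (A B C : set E) (l : E).

Definition Pck C := [/\ C !=set0, convex_set (C : set (convex_lmodType E)) & compact C].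

Definition set_norm A : \bar R := ereal_sup [set (enorm a)%:E | a in A].

(* A real number on nonempty compact sets. *)
Definition hausdorff_dist A B : \bar R :=
  maxe (ereal_sup [set ereal_inf [set (enorm (a - b))%:E | b in B] | a in A])
       (ereal_sup [set ereal_inf [set (enorm (a - b))%:E | a in A] | b in B]).

Definition exposed_face l C : set E :=
  [set c | C c /\ forall x, C x -> edot l x <= edot l c].

Definition exposing C : set E := [set l | exists c, exposed_face l C = [set c]].

(* The default value 0 is never used when [exposing C l]. *)
Definition exposed_point l C : E := xget 0 (exposed_face l C).

Definition demyanov_dist A B : \bar R :=
  ereal_sup [set (enorm (exposed_point l A - exposed_point l B))%:E
            | l in exposing A `&` exposing B].

(* Kuratowski's upper limit Ls. *)
Definition upper_limit (A : nat -> set E) : set E :=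
  [set x | exists (k : nat -> nat) (u : nat -> E),
    [/\ {homo k : m n / (m < n)%N}, forall n, A (k n) (u n) & u @ \oo --> x]].

End Sets.

Section Steiner.
Context {R : realType}.

Local Notation mR := (measurableTypeR R).

Definition cons_tuple (m : nat) (z : mR * m.-tuple mR) : m.+1.-tuple mR :=
  [tuple of z.1 :: z.2].

Lemma measurable_cons_tuple m : measurable_fun [set: mR * m.-tuple mR] (@cons_tuple m).
Proof. exact: measurable_cons. Qed.

Section Step.
Context (m : nat) (mu : {sigma_finite_measure set (m.-tuple mR) -> \bar R}).
Local Open Scope ereal_scope.

Let leb : {sigma_finite_measure set mR -> \bar R} := lebesgue_measure.

Definition lebesgue_cons : set (m.+1.-tuple mR) -> \bar R :=
  pushforward (leb \x mu) (@cons_tuple m).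

Let mcons (A : set (m.+1.-tuple mR)) : measurable A ->
  measurable (@cons_tuple m @^-1` A).
Proof.
by move=> mA; rewrite -[X in measurable X]setTI; exact: measurable_cons_tuple.
Qed.

Let lebesgue_cons0 : lebesgue_cons set0 = 0.
Proof. by rewrite /lebesgue_cons /pushforward preimage_set0 measure0. Qed.

Let lebesgue_cons_ge0 A : 0 <= lebesgue_cons A.
Proof. by rewrite /lebesgue_cons /pushforward; exact: measure_ge0. Qed.

Let lebesgue_cons_sigma_additive : semi_sigma_additive lebesgue_cons.
Proof.
move=> F mF tF mUF; rewrite /lebesgue_cons /pushforward preimage_bigcup.
apply: measure_semi_sigma_additive.
- by move=> n; exact: mcons.
- apply/trivIsetP => /= i j _ _ ij; rewrite -preimage_setI.
  by move/trivIsetP : tF => /(_ _ _ _ _ ij) ->//; rewrite preimage_set0.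
- by rewrite -preimage_bigcup; exact: mcons.
Qed.

HB.instance Definition _ := isMeasure.Build _ _ _ lebesgue_cons
  lebesgue_cons0 lebesgue_cons_ge0 lebesgue_cons_sigma_additive.

Let lebesgue_cons_sigma_finite : sigma_finite setT lebesgue_cons.
Proof.
have /sigma_finiteP[F [TF ndF Foo]] := sigma_finiteT leb.
have /sigma_finiteP[G [TG ndG Goo]] := sigma_finiteT mu.
pose uncons (t : m.+1.-tuple mR) : mR * m.-tuple mR := (thead t, [tuple of behead t]).
have consK : cancel (@cons_tuple m) uncons.
  by move=> [x t]; rewrite /uncons theadE; congr pair; exact: val_inj.
exists (fun n => uncons @^-1` (F n `*` G n)).
  apply/esym; rewrite -subTset => t _.
  have : setT (thead t) by [].
  have : setT [tuple of behead t] by [].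
  rewrite {1}TF {1}TG => -[k _ Gk] [n _ Fn]; exists (maxn n k) => //; split => /=.
  - by move: Fn; exact/subsetPset/ndF/leq_maxl.
  - by move: Gk; exact/subsetPset/ndG/leq_maxr.
move=> k; have [mF Fk] := Foo k; have [mG Gk] := Goo k; split; last first.
  rewrite /lebesgue_cons /pushforward (_ : _ @^-1` _ = F k `*` G k).
    by rewrite product_measure1E// lte_mul_pinfty// ge0_fin_numE.
  by apply/seteqP; split => z; rewrite /preimage/mkset consK.
rewrite -[X in measurable X]setTI.
have : measurable_fun setT uncons; last by apply => //; exact: measurableX.
apply/measurable_fun_pairP; split.
  exact: (measurable_tnth ord0).
exact: measurable_behead.
Qed.

HB.instance Definition _ := Measure_isSigmaFinite.Build _ _ _ lebesgue_cons
  lebesgue_cons_sigma_finite.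

End Step.

(* Lebesgue measure on R^m, as an iterated product measure. *)
Fixpoint lebesgue_tuple (m : nat) :
    {sigma_finite_measure set (m.-tuple mR) -> \bar R} :=
  match m with
  | 0 => \d_ ([tuple] : 0.-tuple mR)
  | m'.+1 => lebesgue_cons (lebesgue_tuple m')
  end.

(* The product sigma-algebra lives on tuples, the linear structure on column
   vectors. *)
Definition col_of_tuple (m : nat) (t : m.-tuple (measurableTypeR R)) : 'cV[R]_m :=
  \col_i tnth t i.

Definition unit_ball (m : nat) : set 'cV[R]_m := [set x | enorm x <= 1].

Definition steiner (m : nat) (C : set 'cV[R]_m) : 'cV[R]_m :=
  \col_i ((fine (lebesgue_tuple m (@col_of_tuple m @^-1` @unit_ball m)))^-1 *
    \int[lebesgue_tuple m]_(t in @col_of_tuple m @^-1` (exposing C `&` @unit_ball m))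
      exposed_point (col_of_tuple t) C i 0).

(* The sharp Lipschitz constant of the Steiner point: a finite infimum of
   Lipschitz constants is itself one. *)
Definition steiner_constant (m : nat) : \bar R :=
  ereal_inf [set k%:E | k in [set k : R | 0 <= k /\
    forall A B : set 'cV[R]_m, Pck A -> Pck B ->
      ((enorm (steiner A - steiner B))%:E <= k%:E * hausdorff_dist A B)%E]].

End Steiner.

Section Time.
Context {R : realType} (T : {posnum R}).

(* [set_type] carries the topology induced by R. *)
Definition time : Type := set_type [set` `[0, T%:num]].

HB.instance Definition _ := Topological.on time.

Definition time_val (t : time) : R := \val t.

Lemma time_val_itv (t : time) : 0 <= time_val t <= T%:num.
Proof. by have := set_mem (valP t); rewrite /= in_itv. Qed.

Lemma time_itv (r : R) : 0 <= r <= T%:num -> r \in [set` `[0, T%:num]].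
Proof. by move=> r0T; apply/mem_set; rewrite /= in_itv. Qed.

Definition to_time (r : R) (r0T : 0 <= r <= T%:num) : time := exist _ r (time_itv r0T).

End Time.

Section Hoelder.
Context {R : realType} {T : {posnum R}}.
Local Open Scope ereal_scope.

Definition sup_norm X (nrm : X -> \bar R) (F : time T -> X) : \bar R :=
  ereal_sup [set nrm (F t) | t in [set: time T]].

Definition holder_seminorm X (dist : X -> X -> \bar R) (alpha : R)
    (F : time T -> X) : \bar R :=
  ereal_sup [set dist (F st.1) (F st.2)
                   * ((time_val st.2 - time_val st.1) `^ alpha)^-1%:E
            | st in [set st | (time_val st.1 < time_val st.2)%R]].

(* A point a stands for the multifunction value {a}: [point_norm a] is
   [set_norm [set a]] and [point_dist a b] is [hausdorff_dist [set a] [set b]]. *)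
Definition point_norm p q (a : 'M[R]_(p, q)) : \bar R := (enorm a)%:E.

Definition point_dist p q (a b : 'M[R]_(p, q)) : \bar R := (enorm (a - b))%:E.

Definition holder_norm p q (alpha : R) (f : time T -> 'M[R]_(p, q)) : \bar R :=
  sup_norm (@point_norm p q) f + holder_seminorm (@point_dist p q) alpha f.

Definition holder_set_norm p q (alpha : R) (F : time T -> set 'M[R]_(p, q)) :=
  sup_norm set_norm F + holder_seminorm hausdorff_dist alpha F.

Definition holder_multifunction p q (alpha : R) (F : time T -> set 'M[R]_(p, q)) :=
  (forall t, Pck (F t)) /\ holder_seminorm hausdorff_dist alpha F < +oo.

End Hoelder.

Definition holder_pred (R : realType) (T : {posnum R}) (alpha : R) (p q : nat) :
    {pred time T -> 'M[R]_(p, q)} :=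
  [pred f | holder_seminorm (@point_dist R p q) alpha f < +oo]%E.
Arguments holder_pred {R} T alpha p q.

Record holder_space (R : realType) (T : {posnum R}) (alpha : R) (p q : nat) := HolderFun {
  holder_fun :> time T -> 'M[R]_(p, q) ;
  holder_finite : holder_fun \in holder_pred T alpha p q }.

HB.instance Definition _ R T alpha p q := [isSub for @holder_fun R T alpha p q].
HB.instance Definition _ R T alpha p q := [Choice of @holder_space R T alpha p q by <:].

Section HolderNorm.
Context {R : realType} {T : {posnum R}} {alpha : R} {p q : nat}.
Implicit Types f g : time T -> 'M[R]_(p, q).

Local Notation seminorm := (holder_seminorm (@point_dist R p q) alpha).
Local Notation supnorm := (sup_norm (@point_norm R p q)).

Let time0 : time T := to_time (r := 0) (introT andP (conj (lexx 0) (ltW (gt0 T)))).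
Let timeT : time T := to_time (r := T%:num) (introT andP (conj (ltW (gt0 T)) (lexx _))).

Let time0T : (time_val time0 < time_val timeT)%R.
Proof. by rewrite /time_val/=. Qed.

Lemma holder_seminorm_leP f (c : R) : (seminorm f <= c%:E)%E <->
  forall s t, time_val s < time_val t ->
    enorm (f s - f t) <= c * (time_val t - time_val s) `^ alpha.
Proof.
split=> [fc s t st|fc].
  have d0 : 0 < (time_val t - time_val s) `^ alpha by rewrite powR_gt0// subr_gt0.
  rewrite -ler_pdivrMr// -lee_fin; apply: le_trans fc.
  by apply: ereal_sup_ubound; exists (s, t).
apply: ge_ereal_sup => _ [[s t] /= st <-].
rewrite /point_dist -EFinM lee_fin ler_pdivrMr ?powR_gt0 ?subr_gt0//.
exact: fc.
Qed.

Lemma holder_seminorm_ge0 f : (0 <= seminorm f)%E.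
Proof.
apply: le_ereal_sup_tmp; eexists; first by exists (time0, timeT); first exact: time0T.
by rewrite mule_ge0// lee_fin ?enorm_ge0// invr_ge0 powR_ge0.
Qed.

Lemma sup_norm_leP f (c : R) : (supnorm f <= c%:E)%E <-> forall t, enorm (f t) <= c.
Proof.
split=> [fc t|fc]; last by apply: ge_ereal_sup => _ [t _ <-]; rewrite lee_fin.
by rewrite -lee_fin; apply: le_trans fc; apply: ereal_sup_ubound; exists t.
Qed.

Lemma sup_norm_ge0 f : (0 <= supnorm f)%E.
Proof.
apply: le_ereal_sup_tmp; eexists; first by exists time0.
by rewrite lee_fin enorm_ge0.
Qed.

Lemma holder_sup_norm_fin f : (seminorm f < +oo)%E -> (supnorm f < +oo)%E.
Proof.
move=> foo; have /holder_seminorm_leP : (seminorm f <= (fine (seminorm f))%:E)%E.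
  by rewrite fineK// ge0_fin_numE// holder_seminorm_ge0.
set c := fine _ => fc.
have c0 : 0 <= c by rewrite fine_ge0// holder_seminorm_ge0.
pose b := T%:num `^ alpha + (T%:num / 2) `^ alpha.
have powb u : T%:num / 2 <= u -> u <= T%:num -> u `^ alpha <= b.
  move=> Tu uT; have T2 : 0 < T%:num / 2 by [].
  have u0 : 0 < u by apply: lt_le_trans Tu.
  have [a0|a0] := leP 0 alpha.
    by apply: ler_wpDr; rewrite ?powR_ge0// ge0_ler_powR// nnegrE ltW.
  apply: ler_wpDl; rewrite ?powR_ge0//.
  rewrite -(opprK alpha) (powRN u) (powRN (_ / 2)).
  rewrite lef_pV2 ?posrE ?powR_gt0//.
  by rewrite ge0_ler_powR// ?nnegrE ?oppr_ge0 ltW.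
apply: (@le_lt_trans _ _ (enorm (f time0) + enorm (f timeT) + c * b)%:E); last exact: ltry.
apply/sup_norm_leP => t; have /andP[t0 tT] := time_val_itv t.
have [Tt|Tt] := leP (T%:num / 2) (time_val t).
  have st : time_val time0 < time_val t.
    by rewrite /time_val/=; apply: lt_le_trans Tt; rewrite divr_gt0.
  have := fc _ _ st; rewrite [time_val time0]/time_val/= subr0 => h.
  have := ler_wpM2l c0 (powb _ Tt tT).
  have := enorm_ge0 (f timeT).
  have := ler_enormD (f time0) (- (1 : R) *: (f time0 - f t)).
  rewrite enormZ normrN normr1 mul1r scaleN1r opprB addrC subrK.
  by lra.
have st : time_val t < time_val timeT.
  by rewrite [X in _ < X]/time_val/=; apply: lt_le_trans Tt _; rewrite ler_pdivrMr// ler_peMr// ler1n.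
have := fc _ _ st; rewrite [time_val timeT]/time_val/= => h.
have Ht : T%:num / 2 <= T%:num - time_val t by lra.
have Ht' : T%:num - time_val t <= T%:num by lra.
have := ler_wpM2l c0 (powb _ Ht Ht').
have := enorm_ge0 (f time0).
have := ler_enormD (f t - f timeT) (f timeT).
rewrite subrK.
by lra.
Qed.

Lemma holder_normE f : (seminorm f < +oo)%E ->
  holder_norm alpha f = (fine (supnorm f) + fine (seminorm f))%:E.
Proof.
move=> foo; rewrite /holder_norm EFinD !fineK//.
  by rewrite ge0_fin_numE// holder_seminorm_ge0.
by rewrite ge0_fin_numE ?holder_sup_norm_fin// sup_norm_ge0.
Qed.

Lemma holder_seminormD f g : (seminorm (f + g)%R <= seminorm f + seminorm g)%E.
Proof.
apply: ge_ereal_sup => _ [[s t] /= st <-].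
apply: (@le_trans _ _ (point_dist (f s) (f t) * ((time_val t - time_val s) `^ alpha)^-1%:E
  + point_dist (g s) (g t) * ((time_val t - time_val s) `^ alpha)^-1%:E)%E).
  rewrite /point_dist -!EFinM -EFinD lee_fin -mulrDl ler_wpM2r ?invr_ge0 ?powR_ge0//.
  apply: le_trans (ler_enormD _ _).
  by rewrite [(f + g) s]/(f s + g s) [(f + g) t]/(f t + g t) opprD addrACA.
by apply: leeD; apply: ereal_sup_ubound; exists (s, t).
Qed.

Lemma sup_normD f g : (supnorm (f + g)%R <= supnorm f + supnorm g)%E.
Proof.
apply: ge_ereal_sup => _ [t _ <-].
apply: (@le_trans _ _ (point_norm (f t) + point_norm (g t))%E).
  by rewrite /point_norm -EFinD lee_fin; exact: ler_enormD.
by apply: leeD; apply: ereal_sup_ubound; exists t.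
Qed.

Lemma holder_seminormZ k f : seminorm (k *: f) = (`|k|%:E * seminorm f)%E.
Proof.
rewrite /holder_seminorm -ereal_supZl//; last first.
  by apply/set0P; eexists; exists (time0, timeT); first exact: time0T.
congr ereal_sup; rewrite image_comp; apply: eq_imagel => -[s t] _ /=.
rewrite /point_dist [(k *: f) s]/(k *: f s) [(k *: f) t]/(k *: f t) -scalerBr enormZ.
by rewrite EFinM -muleA.
Qed.

Lemma sup_normZ k f : supnorm (k *: f) = (`|k|%:E * supnorm f)%E.
Proof.
rewrite /sup_norm -ereal_supZl//; last by apply/set0P; eexists; exists time0.
congr ereal_sup; rewrite image_comp; apply: eq_imagel => t _ /=.
by rewrite /point_norm [(k *: f) t]/(k *: f t) enormZ EFinM.
Qed.

Lemma holder_submod : submod_closed (holder_pred T alpha p q).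
Proof.
split=> [|k f g]; rewrite ?inE.
  apply: (@le_lt_trans _ _ 0%:E); last exact: ltry.
  apply/holder_seminorm_leP => s t st.
  by rewrite [X in enorm X](_ : _ = 0) ?enorm0 ?mul0r// /GRing.zero/= subrr.
move=> foo goo; apply: le_lt_trans (holder_seminormD _ _) _.
apply: lte_add_pinfty => //; by rewrite holder_seminormZ lte_mul_pinfty// lee_fin.
Qed.

End HolderNorm.

Section HolderSpace.
Context {R : realType} {T : {posnum R}} {alpha : R} {p q : nat}.

HB.instance Definition _ := GRing.isSubmodClosed.Build R (time T -> 'M[R]_(p, q))
  (holder_pred T alpha p q) holder_submod.
HB.instance Definition _ := [SubChoice_isSubLmodule of holder_space T alpha p q by <:].

Definition holder_space_norm (f : holder_space T alpha p q) : R := fine (holder_norm alpha f).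

Lemma holder_seminorm_lty (f : holder_space T alpha p q) :
  (holder_seminorm (@point_dist R p q) alpha f < +oo)%E.
Proof. by have := holder_finite f; rewrite inE. Qed.

Let normE f : holder_space_norm f =
  fine (sup_norm (@point_norm R p q) f) + fine (holder_seminorm (@point_dist R p q) alpha f).
Proof. by rewrite /holder_space_norm holder_normE// holder_seminorm_lty. Qed.

Let EnormE f : (holder_space_norm f)%:E = holder_norm alpha f.
Proof. by rewrite normE holder_normE// holder_seminorm_lty. Qed.

Let normD f g : holder_space_norm (f + g) <= holder_space_norm f + holder_space_norm g.
Proof.
rewrite -lee_fin EFinD !EnormE /holder_norm addeACA.
by apply: leeD; [exact: sup_normD|exact: holder_seminormD].
Qed.

Let normZ k f : holder_space_norm (k *: f) = `|k| * holder_space_norm f.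
Proof.
apply: EFin_inj; rewrite EFinM !EnormE /holder_norm.
rewrite [holder_fun _]/(k *: holder_fun f) sup_normZ holder_seminormZ.
by rewrite ge0_muleDr ?sup_norm_ge0// holder_seminorm_ge0.
Qed.

Let norm0 f : holder_space_norm f = 0 -> f = 0.
Proof.
rewrite normE => f0; apply: val_inj; apply/funext => t; apply: enorm0_eq0.
apply/eqP; rewrite eq_le enorm_ge0 andbT.
have : (sup_norm (@point_norm R p q) f <= 0%:E)%E; last by move/sup_norm_leP; exact.
have s0 := sup_norm_ge0 (f : time T -> 'M[R]_(p, q)).
have h0 := holder_seminorm_ge0 (alpha := alpha) (f : time T -> 'M[R]_(p, q)).
move/eqP : f0; rewrite paddr_eq0 ?fine_ge0// => /andP[/eqP f0 _].
by rewrite -f0 fineK// ge0_fin_numE// (holder_sup_norm_fin (holder_seminorm_lty f)).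
Qed.

(* The norm of [holder_space] is N_{alpha, T}; the library's [compact] and
   [closed] then refer to it. *)
HB.instance Definition _ := Lmodule_isNormed.Build R (holder_space T alpha p q)
  normD normZ norm0.

End HolderSpace.

Section Young.
Context {R : realType} {T : {posnum R}}.

(* The Borel sets of [0, T] are the Borel sets of R contained in it. *)
Definition time_measurable p q (f : time T -> 'M[R]_(p, q)) : Prop :=
  forall i j (U : set R), measurable U ->
    measurable (@time_val R T @` [set t | U (f t i j)]).

(* 0 = u_0 < ... < u_n = t, with n = 0 when t = 0. *)
Definition dissection (t : time T) (n : nat) (u : nat -> time T) : Prop :=
  [/\ time_val (u 0) = 0, u n = t &
      forall k, (k < n)%N -> time_val (u k) < time_val (u k.+1)].

Definition is_young_integral (l d : nat) (f : time T -> 'M[R]_(l, d))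
    (w : time T -> 'cV[R]_d) (t : time T) (I : 'cV[R]_l) : Prop :=
  forall eps : R, 0 < eps -> exists2 delta : R, 0 < delta &
    forall n u, dissection t n u ->
      (forall k, (k < n)%N -> time_val (u k.+1) - time_val (u k) < delta) ->
      enorm (\sum_(k < n) f (u k) *m (w (u k.+1) - w (u k)) - I) < eps.

Definition holder_selection (p q : nat) (alpha r : R) (F : time T -> set 'M[R]_(p, q)) :
    set (time T -> 'M[R]_(p, q)) :=
  [set f | [/\ time_measurable f, forall t, F t (f t) &
    (holder_seminorm (@point_dist R p q) alpha f <= r%:E)%E]].

Definition aumann_young (l d : nat) (alpha r : R) (F : time T -> set 'M[R]_(l, d))
    (w : time T -> 'cV[R]_d) (t : time T) : set 'cV[R]_l :=
  [set I | exists2 f, holder_selection alpha r F f & is_young_integral f w t I].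

(* x |-> Phi(., x(.)) *)
Definition superposition (e l d : nat) (Phi : time T * 'cV[R]_e -> set 'M[R]_(l, d))
    (x : time T -> 'cV[R]_e) : time T -> set 'M[R]_(l, d) :=
  fun t => Phi (t, x t).

End Young.

(* Main.v *)
(** Gamma = Psi o Phi_w has nonempty convex values in the compact convex set S,
so by the Kakutani-Fan-Glicksberg theorem it suffices that its graph is closed.
If x_n -> x and z_n = \int_0^t f_n dw -> z, where f_n is a selection of
Phi(., x_n(.)) with alpha-Hoelder seminorm at most r, then f_n converges
pointwise along an ultrafilter to a selection f of Phi(., x(.)) with the same
bound. By Young's estimate the Riemann sums approximate the integrals uniformly
in n, so z = \int_0^t f dw. Hence Ls Phi_w(x_n)(t) is contained in Phi_w(x)(t),
and condition 1 applies.

The fixed point theorem follows from Brouwer's theorem on a cube, which is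
derived from Kuhn's cubical version of Sperner's lemma; the parity count behind
the latter is carried out with determinants in characteristic 2. *)
Require Import Defs.
From mathcomp Require Import all_boot all_order all_algebra all_fingroup.
From mathcomp Require Import all_classical all_reals all_analysis.
From mathcomp Require Import measurable_realfun.
From mathcomp Require Import ring lra zify.

Set Implicit Arguments.
Unset Strict Implicit.
Unset Printing Implicit Defensive.

Import Order.TTheory GRing.Theory Num.Theory.
Import numFieldNormedType.Exports.

Local Open Scope classical_set_scope.
Local Open Scope ring_scope.

(** * Kuhn's lemma *)

Section Kuhn.
Context {F : comNzRingType} (F2 : forall x : F, x + x = 0).

(** Row i is the indicator of the label [u i]: in characteristic 2 the determinant is 1 when the
    first k labels are 0, ..., k - 1 in some order, and 0 otherwise. *)
Definition label_mx k (u : nat -> nat) : 'M[F]_k :=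
  \matrix_(i < k, a < k) (u i == a)%:R.

(** A label that never occurs leaves a zero column. *)
Lemma det_label_mx_eq0 k (u : nat -> nat) (a : 'I_k) :
  (forall i, (i < k)%N -> u i != a) -> \det (label_mx k u) = 0.
Proof.
move=> ua; rewrite (expand_det_col _ a) big1// => i _.
by rewrite mxE (negbTE (ua _ (ltn_ord i))) mul0r.
Qed.

Lemma eq_label_mx k (u v : nat -> nat) :
  (forall i, (i < k)%N -> u i = v i) -> label_mx k u = label_mx k v.
Proof. by move=> uv; apply/matrixP => i a; rewrite !mxE uv. Qed.

Lemma char2_sign n : (-1) ^+ n = 1 :> F.
Proof.
rewrite (_ : -1 = 1 :> F) ?expr1n//.
by apply/eqP; rewrite eq_sym -addr_eq0 F2.
Qed.

(* Adding all the columns to the last one turns it into a column of ones,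
   along which the determinant is then expanded. *)
Lemma det_label_mx_faces k (u : nat -> nat) :
  (forall i, (i <= k)%N -> (u i <= k)%N) ->
  \det (label_mx k.+1 u) =
  \sum_(m < k.+1) \det (label_mx k (fun i => u (bump m i))).
Proof.
move=> uk.
pose U : 'M[F]_k.+1 := \matrix_(a, b) ((a == b) || (b == ord_max))%:R.
have detU : \det U = 1.
  rewrite -det_tr det_trig.
    by rewrite big1// => i _; rewrite !mxE eqxx.
  apply/is_trig_mxP => i j ij; rewrite !mxE.
  rewrite (_ : (j == i) = false); last by apply/eqP => e; rewrite e ltnn in ij.
  rewrite (_ : (i == ord_max) = false)//; apply/eqP => e.
  by move: ij; rewrite e ltnNge -ltnS ltn_ord.
rewrite -[LHS]mulr1 -detU -det_mulmx (expand_det_col _ ord_max).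
apply: eq_bigr => m _; rewrite mxE (bigD1 (inord (u m)))//= !mxE eqxx orbT mulr1.
have um : (u m < k.+1)%N by rewrite ltnS uk// -ltnS.
rewrite inordK// eqxx big1 ?addr0 ?mul1r; last first.
  move=> a am; rewrite !mxE eqxx orbT mulr1 (_ : (_ == _) = false)//.
  apply/negbTE/eqP => e; move/eqP: am; apply; apply: val_inj.
  by rewrite /= inordK.
rewrite /cofactor char2_sign mul1r; congr (\det _); apply/matrixP => i a.
rewrite !mxE (bigD1 (lift ord_max a))//= !mxE eqxx /= mulr1.
rewrite big1 ?addr0; last first.
  move=> b ba; rewrite !mxE (negbTE ba) (_ : lift _ _ == _ = false) ?mulr0//.
  by apply/negbTE; rewrite eq_sym neq_lift.
by rewrite /= /bump [(k <= a)%N]leqNgt ltn_ord.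
Qed.

(** * Simplices of the cube and the parity of full labellings *)

Context {N p : nat} (lab : {ffun 'I_N -> nat} -> nat).
Hypothesis lab_le : forall x, (lab x <= N)%N.
Hypothesis lab0 : forall (x : {ffun 'I_N -> nat}) (j : 'I_N), x j = 0%N -> lab x != j.
Hypothesis labp : forall (x : {ffun 'I_N -> nat}) (j : 'I_N), x j = p -> (lab x <= j)%N.

(* s j is the rank of the direction j: the i-th vertex of the simplex is reached
   from q by increasing the coordinates of rank less than i. *)
Definition kuhn_vertex (q : {ffun 'I_N -> 'I_p.+1}) (s : 'S_N) (i : nat) :
    {ffun 'I_N -> nat} := [ffun j => (q j + (s j < i))%N].

(** Base points of the unit cells of the k-dimensional face on which every coordinate of index at
    least k equals p. *)
Definition kuhn_base k (q : {ffun 'I_N -> 'I_p.+1}) :=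
  [forall j : 'I_N, (q j < p)%N == (j < k)%N].

Definition kuhn_perm k (s : 'S_N) := [forall j : 'I_N, (k <= j)%N ==> (s j == j)].

(** The number, modulo 2, of k-simplices in that face carrying all the labels 0, ..., k. *)
Definition kuhn_count k : F :=
  \sum_(s | kuhn_perm k s) \sum_(q | kuhn_base k q)
    \det (label_mx k.+1 (fun i => lab (kuhn_vertex q s i))).

(** For k < N, direction k has rank k, so coordinate k still equals p at the vertices of index at
    most k and [labp] applies. For k = N the bound is [lab_le]. *)
Lemma lab_kuhn_vertex k q s i : (k <= N)%N -> kuhn_base k q -> kuhn_perm k s ->
  (i <= k)%N -> (lab (kuhn_vertex q s i) <= k)%N.
Proof.
move=> kN qk sk ik; have [k_lt|] := ltnP k N; last by move=> Nk; apply: leq_trans Nk.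
apply: (@labp _ (Ordinal k_lt)); rewrite ffunE.
have /implyP/(_ (leqnn k))/eqP-> := forallP sk (Ordinal k_lt).
rewrite /= ltnNge ik addn0; apply/eqP.
have := forallP qk (Ordinal k_lt); rewrite /= ltnn => /eqP/negbT.
by rewrite -leqNgt => h; rewrite eqn_leq h -ltnS ltn_ord.
Qed.

(** The 0-dimensional face is the single vertex (p, ..., p), whose label can only be 0. *)
Lemma kuhn_count0 : kuhn_count 0 = 1.
Proof.
rewrite /kuhn_count (bigD1 1%g)/=; last by apply/forallP => j; rewrite perm1 eqxx implybT.
rewrite [X in _ + X]big1 ?addr0; last first.
  move=> s /andP[/forallP s0 /eqP]; case; apply/permP => j; rewrite perm1.
  exact/eqP/(implyP (s0 j)).
rewrite (bigD1 [ffun=> ord_max])/=; last by apply/forallP => j; rewrite ffunE/= ltnn ltn0.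
rewrite [X in _ + X]big1 ?addr0; last first.
  move=> q /andP[/forallP q0 /eqP]; case; apply/ffunP => j; rewrite ffunE.
  apply/val_inj/eqP => /=; rewrite eqn_leq -ltnS ltn_ord/= leqNgt.
  by have /eqP-> := q0 j; rewrite ltn0.
rewrite det_mx11 mxE -leqn0 lab_kuhn_vertex//.
  by apply/forallP => j; rewrite ffunE/= ltnn ltn0.
by apply/forallP => j; rewrite perm1 eqxx implybT.
Qed.

(* The faces opposite an inner vertex cancel in pairs: swapping the ranks m and
   m.+1 only changes the vertex of index m.+1. *)
Lemma kuhn_inner_faces k m q : (m.+1 < k)%N -> (k <= N)%N ->
  \sum_(s | kuhn_perm k s)
    \det (label_mx k (fun i => lab (kuhn_vertex q s (bump m.+1 i)))) = 0.
Proof.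
move=> mk kN.
have m1N : (m.+1 < N)%N by exact: leq_trans kN.
have mN : (m < N)%N by exact: ltnW.
pose t := tperm (Ordinal mN) (Ordinal m1N).
have tk s : kuhn_perm k (s * t)%g = kuhn_perm k s.
  have tj (j : 'I_N) : (k <= j)%N -> t j = j.
    move=> kj; apply: tpermD; apply/eqP => /(congr1 val)/= e; move: kj; rewrite -e; lia.
  apply: eq_forallb => j; rewrite permM; have [kj|] := leqP k j => //=.
  by apply/eqP/eqP => [|->]; [rewrite -{2}(tj _ kj); exact: perm_inj|exact: tj].
rewrite (bigID (@odd_perm _))/= (reindex_inj (mulIg t))/=.
rewrite (eq_bigl (fun s => kuhn_perm k s && ~~ odd_perm s)); last first.
  move=> s; rewrite tk odd_permM odd_tperm.
  by rewrite (_ : (_ != _) = true) ?addbT//; apply/eqP => /(congr1 val)/= /n_Sn.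
rewrite -big_split/= big1// => s _.
rewrite [X in X + _](_ : _ = \det (label_mx k (fun i => lab (kuhn_vertex q s (bump m.+1 i))))).
  exact: F2.
congr (\det _); apply: eq_label_mx => i ik; congr lab; apply/ffunP => j.
rewrite !ffunE; congr (_ + nat_of_bool _)%N; rewrite permM.
case: tpermP => [->|->|//] /=; rewrite /bump; case: ltnP => mi; apply/idP/idP; rewrite ?add1n ?add0n; lia.
Qed.

Section Step.
Context {k : nat} (kN : (k < N)%N).

Let K : 'I_N := Ordinal kN.

(** Cyclic shift of the ranks 0, ..., k; its inverse makes the last rank k the first one. *)
Let rot_fun (i : 'I_N) : 'I_N :=
  insubd i (if i == 0%N :> nat then k else if (i <= k)%N then i.-1 else i).

Let rot_funE (i : 'I_N) :
  rot_fun i = (if i == 0%N :> nat then k else if (i <= k)%N then i.-1 else i) :> nat.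
Proof.
rewrite /rot_fun insubdK// -topredE /=; case: ifP => // _; case: ifP => // ik.
by apply: leq_ltn_trans (leq_pred _) _.
Qed.

Let rot_inj : injective rot_fun.
Proof.
move=> i j /(congr1 val) /=; rewrite !rot_funE => e; apply: val_inj => /=.
by move: e; repeat case: ifPn; lia.
Qed.

Let rot := perm rot_inj.

Let rotE (i : 'I_N) :
  rot i = (if i == 0%N :> nat then k else if (i <= k)%N then i.-1 else i) :> nat.
Proof. by rewrite permE rot_funE. Qed.

Let kuhn_perm_rot s : kuhn_perm k.+1 (s * rot^-1)%g = kuhn_perm k.+1 s.
Proof.
have rj (j : 'I_N) : (k < j)%N -> rot j = j.
  by move=> kj; apply: val_inj => /=; rewrite rotE; repeat case: ifPn; lia.
apply: eq_forallb => j; rewrite permM; have [kj|] := ltnP k j => //=.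
apply/eqP/eqP => [e|->]; last by rewrite -{1}(rj _ kj) permK.
by rewrite -[LHS](permKV rot) e rj.
Qed.

Let shift (j : 'I_N) (q : {ffun 'I_N -> 'I_p.+1}) : {ffun 'I_N -> 'I_p.+1} :=
  [ffun i => if i == j then inord (q i).+1 else q i].

(** Direction j is used first instead of last: the face opposite the first vertex of one simplex is
    the face opposite the last vertex of the simplex based one step further along j. *)
Let kuhn_vertex_rot (q : {ffun 'I_N -> 'I_p.+1}) (s : 'S_N) (j : 'I_N) i :
  s j = K -> (q j < p)%N -> (i <= k)%N ->
  kuhn_vertex q (s * rot^-1)%g i.+1 = kuhn_vertex (shift j q) s i.
Proof.
move=> sj qj ik; apply/ffunP => x; rewrite !ffunE permM.
have [->|xj] := eqVneq x j.
  rewrite inordK// sj (_ : (rot^-1)%g K = Ordinal (leq_trans (ltn0Sn _) kN)).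
    by rewrite /= ltnNge ik; lia.
  by apply: (@perm_inj _ rot); rewrite permKV; apply: val_inj => /=; rewrite rotE.
have : s x != K by rewrite -sj; apply: contra_neq xj; exact: perm_inj.
have := rotE ((rot^-1)%g (s x)); rewrite permKV => e.
rewrite -(inj_eq val_inj)/= e => h; congr (_ + nat_of_bool _)%N.
move: h; set a := nat_of_ord _ => h; apply/idP/idP; move: h; repeat case: ifPn; lia.
Qed.

Let face q s := \det (label_mx k.+1 (fun i => lab (kuhn_vertex q s i))).

(* The two outer faces telescope along the direction j of the last edge; only
   those on the boundary of the cube remain, and there a label is missing
   unless j is the last coordinate. *)
Let kuhn_outer_faces (s : 'S_N) (j : 'I_N) : kuhn_perm k.+1 s -> s j = K ->
  \sum_(q | kuhn_base k.+1 q) face (shift j q) s + \sum_(q | kuhn_base k.+1 q) face q s =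
  if j == K then \sum_(q | kuhn_base k q) face q s else 0.
Proof.
move=> sk sj.
have jk : (j < k.+1)%N.
  rewrite ltnNge; apply/negP => kj; have /implyP/(_ kj)/eqP sjj := forallP sk j.
  by move: kj; rewrite -sjj sj ltnn.
pose A (q : {ffun 'I_N -> 'I_p.+1}) :=
  [forall i : 'I_N, (i != j) ==> ((q i < p)%N == (i < k.+1)%N)].
have baseE q : kuhn_base k.+1 q = A q && (q j < p)%N.
  apply/forallP/andP => [qk|[/forallP qA qj] i].
    split; last by have /eqP-> := qk j.
    by apply/forallP => i; apply/implyP => _.
  by have [->|/(implyP (qA i))//] := eqVneq i j; rewrite qj jk.
have face0 : \sum_(q | A q && ~~ (0 < q j)%N) face q s = 0.
  apply: big1 => q /andP[_]; rewrite -leqNgt leqn0 => /eqP qj.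
  apply: (@det_label_mx_eq0 _ _ (Ordinal jk)) => i ik; apply: lab0.
  by rewrite ffunE qj sj /= ltnNge -ltnS ik.
(* The shift maps the base points onto the elements of [A] with positive coordinate j; those with
   coordinate 0 contribute nothing. *)
have shiftE : \sum_(q | kuhn_base k.+1 q) face (shift j q) s = \sum_(q | A q) face q s.
  rewrite [RHS](bigID (fun q : {ffun 'I_N -> 'I_p.+1} => (0 < q j)%N))/= face0 addr0.
  pose unshift (q : {ffun 'I_N -> 'I_p.+1}) : {ffun 'I_N -> 'I_p.+1} :=
    [ffun i => if i == j then inord (q i).-1 else q i].
  rewrite [RHS](reindex_onto (shift j) unshift); last first.
    move=> q /andP[_ qj]; apply/ffunP => i; rewrite !ffunE; case: eqP => [->|//].
    apply: val_inj => /=; by rewrite !inordK ?prednK//; exact: ltnW.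
  apply: eq_bigl => q; rewrite baseE.
  rewrite (_ : A (shift j q) = A q); last first.
    by apply: eq_forallb => i; rewrite ffunE; case: (eqVneq i j).
  rewrite -andbA; congr (_ && _); rewrite ffunE eqxx.
  have [qj|pq] := ltnP (q j) p; last first.
    by rewrite val_insubd ltnS ifN// -leqNgt.
  rewrite inordK//=; apply/esym/eqP/ffunP => i; rewrite !ffunE; case: eqP => [->|//].
  by apply: val_inj => /=; rewrite !inordK// ltnW.
rewrite shiftE (bigID (fun q : {ffun 'I_N -> 'I_p.+1} => (q j < p)%N))/= -(eq_bigl _ _ baseE).
rewrite addrAC F2 add0r; case: eqP => [jK|/eqP jK].
  apply: eq_bigl => q; apply/andP/forallP => [[/forallP qA qj] i|qk].
    have [->|ij] := eqVneq i j; first by rewrite (negbTE qj) jK /= ltnn.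
    have /eqP-> := implyP (qA i) ij; rewrite ltnS leq_eqVlt.
    by move: ij; rewrite jK => /negbTE; rewrite -(inj_eq val_inj)/= => ->.
  split; last by have /eqP-> := qk j; rewrite jK ltnn.
  apply/forallP => i; apply/implyP => ij; have /eqP-> := qk i.
  rewrite ltnS [X in _ == X]leq_eqVlt.
  by move: ij; rewrite jK => /negbTE; rewrite -(inj_eq val_inj)/= => ->.
apply: big1 => q /andP[_ qj].
apply: (@det_label_mx_eq0 _ _ ord_max) => i ik /=.
have : (lab (kuhn_vertex q s i) <= j)%N.
  apply: labp; rewrite ffunE sj /= ltnNge -ltnS ik addn0.
  by apply/eqP; rewrite eqn_leq [X in _ && X]leqNgt qj andbT -ltnS ltn_ord.
apply: contraTneq => ->; rewrite -ltnNge ltn_neqAle -ltnS jk andbT.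
exact: jK.
Qed.

(** Each determinant is expanded over the facets of its simplex. Inner faces cancel, and the two
    outer families telescope to the simplices of the k-dimensional face. *)
Lemma kuhn_countS : kuhn_count k.+1 = kuhn_count k.
Proof.
rewrite /kuhn_count.
under eq_bigr => s sk.
  under eq_bigr => q qk.
    rewrite (@det_label_mx_faces k.+1); last by move=> i ik; apply: lab_kuhn_vertex.
    rewrite big_ord_recl big_ord_recr /=.
    over.
  rewrite !big_split /=.
  over.
rewrite !big_split /=.
rewrite [X in _ + (X + _)](_ : _ = 0) ?add0r; last first.
  rewrite exchange_big /= big1// => q _; rewrite exchange_big big1//= => m _.
  by have := @kuhn_inner_faces k.+1 m q; apply; rewrite ?ltnS//.
rewrite (reindex_inj (mulIg (rot^-1)%g))/= (eq_bigl _ _ kuhn_perm_rot).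
rewrite -big_split /=.
(* The direction of last rank is [(s^-1)%g K]; it is [K] exactly when s fixes [K], which cuts
   [kuhn_perm k.+1] down to [kuhn_perm k]. *)
rewrite (eq_bigr (fun s : 'S_N => if s K == K then \sum_(q | kuhn_base k q) face q s else 0)).
  rewrite -big_mkcondr/=; apply: eq_bigl => s.
  apply/andP/forallP => [[/forallP sk sK] j|sk].
    apply/implyP; rewrite leq_eqVlt => /predU1P[kj|]; last exact/implyP.
    by rewrite (_ : j = K)//; exact: val_inj.
  split; last by have /implyP -> := sk K.
  by apply/forallP => j; apply/implyP => kj; apply: (implyP (sk j)); exact: ltnW.
move=> s sk; have sj : s ((s^-1)%g K) = K by rewrite permKV.
rewrite (_ : (s K == K) = ((s^-1)%g K == K)); last first.
  by apply/eqP/eqP => e; [rewrite -{1}e permK|rewrite -{1}e permKV].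
rewrite -kuhn_outer_faces//; congr (_ + _); last first.
  apply: eq_bigr => q _; congr (\det _); apply: eq_label_mx => i ik.
  by rewrite /bump leqNgt ik.
apply: eq_bigr => q qk; congr (\det _); apply: eq_label_mx => i ik.
rewrite -kuhn_vertex_rot//.
have /eqP-> := forallP qk ((s^-1)%g K).
rewrite ltnNge; apply/negP => kj; have /implyP/(_ kj)/eqP := forallP sk ((s^-1)%g K).
by rewrite permKV => sKK; move: kj; rewrite -sKK ltnn.
Qed.

End Step.

Lemma kuhn_count_eq1 k : (k <= N)%N -> kuhn_count k = 1.
Proof. by elim: k => [_|k IH kN]; [exact: kuhn_count0|rewrite kuhn_countS// IH// ltnW]. Qed.

(** The count is 1, so some determinant is nonzero, and a nonzero determinant has no missing
    label. *)
Lemma full_kuhn_simplex : exists (q : {ffun 'I_N -> 'I_p.+1}) (s : 'S_N), kuhn_base N q /\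
  forall a, (a <= N)%N -> exists i, lab (kuhn_vertex q s i) = a.
Proof.
have /eqP : kuhn_count N != 0 by rewrite kuhn_count_eq1// oner_neq0.
have [h _|h c0] := altP (@existsP _ (fun s : 'S_N => [exists q : {ffun 'I_N -> 'I_p.+1},
  kuhn_base N q && (\det (label_mx N.+1 (fun i => lab (kuhn_vertex q s i))) != 0)])).
  have [s /existsP[q /andP[qN d0]]] := h.
  exists q, s; split=> // a aN.
  have [/existsP[i /eqP]|/existsPn ha] :=
    boolP [exists i : 'I_N.+1, lab (kuhn_vertex q s i) == a]; first by exists i.
  case/eqP: d0; apply: (@det_label_mx_eq0 _ _ (Ordinal (aN : (a < N.+1)%N))) => i iN.
  exact: (ha (Ordinal iN)).
case: c0; apply: big1 => s _; apply: big1 => q qN; apply/eqP.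
apply: contraNT h => d0; apply/existsP; exists s; apply/existsP; exists q.
by rewrite qN.
Qed.

End Kuhn.

(** The scalar label [red x] is the first coordinate satisfying [lab x], or N if there is none. In a
    fully labelled simplex the vertex labelled j supplies x, and the one labelled N, where [lab]
    fails everywhere, supplies y. *)
Lemma kuhn_lemma (N p : nat) (lab : {ffun 'I_N -> nat} -> pred 'I_N) :
  (forall (x : {ffun 'I_N -> nat}) (j : 'I_N), x j = 0%N -> ~~ lab x j) ->
  (forall (x : {ffun 'I_N -> nat}) (j : 'I_N), x j = p -> lab x j) ->
  exists q : {ffun 'I_N -> nat}, (forall j, (q j < p)%N) /\
    forall j, exists x y : {ffun 'I_N -> nat}, [/\ forall i, (q i <= x i <= (q i).+1)%N,
      forall i, (q i <= y i <= (q i).+1)%N, lab x j & ~~ lab y j].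
Proof.
move=> lab0 labp; pose red x := find (lab x) (enum 'I_N).
have redP x (j : 'I_N) : lab x j -> (red x <= j)%N.
  move=> xj; rewrite leqNgt; apply/negP => /(before_find j).
  by rewrite nth_ord_enum xj.
have redE x (j : 'I_N) : red x = j -> lab x j.
  move=> xj; have : has (lab x) (enum 'I_N) by rewrite has_find -/(red x) xj size_enum_ord.
  by move/(nth_find j); rewrite -/(red x) xj nth_ord_enum.
have red_le x : (red x <= N)%N by have := find_size (lab x) (enum 'I_N); rewrite size_enum_ord.
have red0 (x : {ffun 'I_N -> nat}) (j : 'I_N) : x j = 0%N -> red x != j.
  by move=> /lab0; apply: contraNneq; exact: redE.
have redp (x : {ffun 'I_N -> nat}) (j : 'I_N) : x j = p -> (red x <= j)%N.
  by move/labp; exact: redP.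
have F2 (x : 'F_2) : x + x = 0 by apply: addrr_pchar2; rewrite pchar_Fp.
have [q [s [qN full]]] := full_kuhn_simplex F2 red_le red0 redp.
exists [ffun j => val (q j)]; split=> [j|j].
  by rewrite ffunE; have /eqP-> := forallP qN j.
have [i xj] := full j (ltnW (ltn_ord j)); have [i' yN] := full N (leqnn N).
exists (kuhn_vertex q s i), (kuhn_vertex q s i'); split.
- by move=> m; rewrite !ffunE leq_addr /=; case: (_ < _)%N; lia.
- by move=> m; rewrite !ffunE leq_addr /=; case: (_ < _)%N; lia.
- exact: redE.
- by apply/negP => /redP; rewrite yN leqNgt ltn_ord.
Qed.

(** * Brouwer's theorem *)

(** Compactness gives a cluster point of the image ultrafilter, and an ultrafilter converges to its
    cluster points. This takes the place of extracting subsequences. *)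
Lemma ultra_cvg {I : Type} {X : topologicalType} (U : set_system I) (u : I -> X)
    (A : set X) :
  UltraFilter U -> compact A -> (forall n, A (u n)) ->
  exists2 z, A z & u n @[n --> U] --> z.
Proof.
move=> ultraU cA uA; have PU : ProperFilter U by exact: ultra_proper.
have uU : (u n @[n --> U]) A. by apply: (@filterE I U); exact: uA.
have [z [Az uz]] := cA _ (fmap_proper_filter u PU) uU.
exists z => // V zV; have [//|UV] := in_ultra_setVsetC (u @^-1` V) ultraU.
by have [y []] := uz (~` V) V UV zV.
Qed.

Lemma cvg_ler {R : realType} {I : Type} {U : set_system I} {FF : ProperFilter U}
    (f g : I -> R) a b :
  (forall n, f n <= g n) -> f n @[n --> U] --> a -> g n @[n --> U] --> b -> a <= b.
Proof.
move=> fg fa gb; rewrite -subr_ge0.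
have gf : \forall n \near U, 0 <= (g - f) n by apply: nearW => n; rewrite subr_ge0.
exact: (closed_cvg (fun y : R => 0 <= y) (@closed_ge R 0) gf _ (cvgB gb fa)).
Qed.

Definition unit_cube {R : realType} {N : nat} : set 'rV[R]_N :=
  [set x | forall i, 0 <= x 0 i <= 1].

Lemma compact_unit_cube (R : realType) N : compact (@unit_cube R N).
Proof.
rewrite (_ : unit_cube = [set v : 'rV[R]_N | forall i, `[0, 1]%classic (v ord0 i)]).
  by apply: (@rV_compact R N (fun=> `[0, 1]%classic)) => i; exact: segment_compact.
by apply/seteqP; split => v /= vi i; have := vi i; rewrite /= in_itv.
Qed.

Lemma cvg_mx_entry (R : realType) I (U : set_system I) {FU : Filter U} p q
    (f : I -> 'M[R]_(p, q)) (A : 'M[R]_(p, q)) i j :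
  f n @[n --> U] --> A -> f n i j @[n --> U] --> A i j.
Proof.
move=> fA; apply: (@cvg_comp _ _ _ f (fun B : 'M[R]_(p, q) => B i j) _ _ _ fA).
exact: coord_continuous.
Qed.

Lemma le_mx_norm (R : realType) p q (A : 'M[R]_(p, q)) (c : R) : 0 <= c ->
  (forall i j, `|A i j| <= c) -> `|A| <= c.
Proof.
move=> c0 Ac; rewrite /Num.Def.normr/= mx_normrE; apply/bigmax_leP.
by split=> // -[i j] _; exact: Ac.
Qed.

(* Along an ultrafilter all the vertices of the cells given by Kuhn's lemma
   converge to the same point, which the two inequalities carried by each
   coordinate show to be fixed. *)
Lemma brouwer_cube (R : realType) N (g : 'rV[R]_N -> 'rV[R]_N) :
  (forall x, unit_cube x -> {for x, continuous g}) ->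
  (forall x, unit_cube x -> unit_cube (g x)) ->
  exists2 x, unit_cube x & g x = x.
Proof.
move=> gcont gcube.
pose pt p (x : {ffun 'I_N -> nat}) : 'rV[R]_N := \row_j ((x j)%:R / p.+1%:R).
pose close p (x y : 'rV[R]_N) := forall i, `|x 0 i - y 0 i| <= p.+1%:R^-1.
have cell p : exists z : 'rV[R]_N * {ffun 'I_N -> 'rV[R]_N} * {ffun 'I_N -> 'rV[R]_N},
    unit_cube z.1.1 /\ forall j, [/\ unit_cube (z.1.2 j), unit_cube (z.2 j),
      close p (z.1.2 j) z.1.1, close p (z.2 j) z.1.1 &
      g (z.1.2 j) 0 j <= z.1.2 j 0 j /\ z.2 j 0 j <= g (z.2 j) 0 j].
  (* The label says that [g] does not increase coordinate j. The tests on the two faces enforce the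
     boundary conditions of Kuhn's lemma; the inequalities remain true there because [g] preserves
     the cube. *)
  pose lab (x : {ffun 'I_N -> nat}) (j : 'I_N) :=
    (0 < x j)%N && ((x j == p.+1) || (g (pt p x) 0 j <= pt p x 0 j)).
  have p0 : 0 < p.+1%:R :> R by rewrite ltr0n.
  have ptcube (x : {ffun 'I_N -> nat}) : (forall i, (x i <= p.+1)%N) -> unit_cube (pt p x).
    by move=> xp i; rewrite mxE divr_ge0//= ler_pdivrMr// mul1r ler_nat.
  have ptclose (q x : {ffun 'I_N -> nat}) : (forall i, (q i <= x i <= (q i).+1)%N) ->
      close p (pt p x) (pt p q).
    move=> qx i; rewrite !mxE -mulrBl normrM [X in _ * X]gtr0_norm ?invr_gt0//.
    have /andP[qxi xqi] := qx i.
    rewrite ler_piMl ?invr_ge0 ?(ltW p0)// -natrB// normr_nat.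
    by rewrite (@ler_nat R _ 1) leq_subLR addn1.
  have [|x j xj|q [qp qlab]] := @kuhn_lemma N p.+1 lab.
  - by move=> x j xj; rewrite /lab xj.
  - by rewrite /lab xj eqxx.
  have /choice[xy xyP] : forall j, exists xy : {ffun 'I_N -> nat} * {ffun 'I_N -> nat},
    [/\ forall i, (q i <= xy.1 i <= (q i).+1)%N,
      forall i, (q i <= xy.2 i <= (q i).+1)%N, lab xy.1 j & ~~ lab xy.2 j].
    by move=> j; have [x [y h]] := qlab j; exists (x, y).
  exists (pt p q, [ffun j => pt p (xy j).1], [ffun j => pt p (xy j).2]) => /=.
  have cubeS (x : {ffun 'I_N -> nat}) : (forall i, (q i <= x i <= (q i).+1)%N) ->
      unit_cube (pt p x).
    move=> qx; apply: ptcube => i; have /andP[_ /leq_trans] := qx i; apply; exact: qp.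
  split=> [|j]; first by apply: ptcube => i; exact: ltnW.
  rewrite !ffunE; have [qx qy xj yj] := xyP j; split; [exact: cubeS|exact: cubeS|
    exact: ptclose|exact: ptclose|split].
    move: xj => /andP[_ /predU1P[xp|//]].
    have /andP[_ /le_trans] := gcube _ (cubeS _ qx) j; apply.
    by rewrite mxE xp divff// gt_eqF.
  have /andP[gy0 _] := gcube _ (cubeS _ qy) j.
  move: yj; rewrite negb_and -leqNgt leqn0 => /orP[/eqP y0|].
    by rewrite [X in X <= _]mxE y0 mul0r.
  by rewrite negb_or -ltNge => /andP[_ /ltW].
have /choice[z zP] := cell.
have [U [ultraU ooU]] := ultraFilterLemma (F := \oo) _.
have [c cube_c zc] := ultra_cvg ultraU (@compact_unit_cube R N) (fun p => (zP p).1).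
have cvg_close (x : nat -> 'rV[R]_N) :
    (forall p, close p (x p) (z p).1.1) -> x p @[p --> U] --> c.
  move=> xz; apply/cvgrPdist_le => e e0.
  have e20 : 0 < e / 2 by rewrite divr_gt0.
  have /cvgrPdist_le/(_ _ e20) zc2 := zc.
  have inv_e : \forall p \near U, p.+1%:R^-1 <= e / 2 :> R.
    apply: ooU; have /cvgrPdist_le/(_ _ e20) := @cvg_harmonic R.
    by apply: filterS => p; rewrite sub0r normrN ger0_norm// invr_ge0.
  apply: filterS2 zc2 inv_e => p zp pe.
  rewrite (splitr e) -(subrKA (z p).1.1); apply: (le_trans (ler_normD _ _)).
  apply: lerD => //; apply: le_trans pe; apply: le_mx_norm; first by rewrite invr_ge0.
  by move=> i j; rewrite ord1 !mxE distrC; exact: xz.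
exists c => //; apply/rowP => j.
have gc : g y @[y --> c] --> g c := gcont c cube_c.
have cvg_g (x : nat -> 'rV[R]_N) : x p @[p --> U] --> c ->
    g (x p) 0 j @[p --> U] --> g c 0 j.
  by move=> xc; apply: cvg_mx_entry; exact: cvg_comp xc gc.
have xc : (z p).1.2 j @[p --> U] --> c.
  by apply: cvg_close => p; have [_ /(_ j)[]] := zP p.
have yc : (z p).2 j @[p --> U] --> c.
  by apply: cvg_close => p; have [_ /(_ j)[]] := zP p.
apply/eqP; rewrite eq_le; apply/andP; split.
  apply: (cvg_ler _ (cvg_g _ xc) (cvg_mx_entry (i := 0) (j := j) xc)).
  by move=> p; have [_ /(_ j)[_ _ _ _ []]] := zP p.
apply: (cvg_ler _ (cvg_mx_entry (i := 0) (j := j) yc) (cvg_g _ yc)).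
by move=> p; have [_ /(_ j)[_ _ _ _ []]] := zP p.
Qed.

(** * The Kakutani-Fan-Glicksberg theorem *)

Section ConvexCombination.
Context {R : realType} {V : lmodType R} (A : set V).
Hypothesis cA : convex_set (A : set (convex_lmodType V)).

Lemma convex_set_conv (t : R) x y : 0 <= t -> t <= 1 -> A x -> A y ->
  A (t *: x + (1 - t) *: y).
Proof.
move=> t0 t1 Ax Ay.
by have := cA (Itv01 t0 t1) (mem_set Ax) (mem_set Ay); rewrite inE.
Qed.

(** Induction on the list: the first point is absorbed into the base point [b], which carries the
    weight missing to reach 1. *)
Lemma convex_set_subsum (I : Type) (s : seq I) (c : I -> R) (a : I -> V) b :
  (forall i, 0 <= c i) -> (forall i, A (a i)) -> A b -> \sum_(i <- s) c i <= 1 ->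
  A (\sum_(i <- s) c i *: a i + (1 - \sum_(i <- s) c i) *: b).
Proof.
move=> c0 Aa; elim: s b => [b Ab _|i s IH b Ab].
  by rewrite !big_nil subr0 scale1r add0r.
rewrite !big_cons => s1; set u := \sum_(j <- s) c j in s1 IH *.
have ci0 := c0 i.
have [u1|u1] := eqVneq u 1.
  have -> : c i = 0 by lra.
  by rewrite scale0r !add0r; apply: IH => //; rewrite u1.
have u1' : 0 < 1 - u by rewrite subr_gt0 lt_def eq_sym u1/=; lra.
set t := c i / (1 - u).
have t0 : 0 <= t by rewrite divr_ge0// ltW.
have t1 : t <= 1 by rewrite ler_pdivrMr// mul1r; lra.
rewrite (_ : _ + _ = \sum_(j <- s) c j *: a j + (1 - u) *: (t *: a i + (1 - t) *: b)).
  by apply: IH; [exact: convex_set_conv|lra].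
have ut : (1 - u) * t = c i by rewrite mulrC divfK// gt_eqF.
rewrite scalerDr !scalerA mulrBr mulr1 ut addrA [_ + c i *: _]addrC.
by rewrite (_ : 1 - (c i + u) = 1 - u - c i); last by lra.
Qed.

Lemma convex_set_sum (I : finType) (c : I -> R) (a : I -> V) :
  (forall i, 0 <= c i) -> (forall i, A (a i)) -> \sum_i c i = 1 ->
  A (\sum_i c i *: a i).
Proof.
move=> c0 Aa c1; have [i _|i0] := pickP (@predT I); last first.
  by move/eqP: c1; rewrite big_pred0// eq_sym oner_eq0.
have := @convex_set_subsum _ (index_enum I) c a (a i) c0 Aa (Aa i).
by rewrite c1 subrr scale0r addr0; apply.
Qed.

End ConvexCombination.

Lemma compact_eps_net (R : realType) (V : normedModType R) (A : set V) (e : R) :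
  0 < e -> compact A ->
  exists N (c : 'I_N -> V), (forall i, A (c i)) /\
    forall x, A x -> exists i, `|x - c i| < e.
Proof.
move=> e0; rewrite compact_cover => cA.
have [||D DA AD] := cA V A (fun x => ball x e).
- by move=> x _; exact: ball_open.
- by move=> x Ax; exists x => //; exact: ballxx.
exists (size (finmap.enum_fset D)), (tnth (in_tuple (finmap.enum_fset D))); split=> [i|x Ax].
  by apply/set_mem/DA; exact: mem_tnth.
have [y /= yD xy] := AD _ Ax.
have /seq_tnthP[i yi] : y \in in_tuple (finmap.enum_fset D) by [].
by exists i; move: xy; rewrite yi -ball_normE/= distrC.
Qed.

(** * Limits of matrices, sums and quotients along a filter *)

Lemma cvg_mx (R : realType) I (U : set_system I) {FU : Filter U} p q
    (f : I -> 'M[R]_(p, q)) (A : 'M[R]_(p, q)) :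
  (forall i j, f n i j @[n --> U] --> A i j) -> f n @[n --> U] --> A.
Proof.
move=> fA; apply/cvgrPdist_le => e e0.
have : \forall n \near U, forall ij : 'I_p * 'I_q, `|A ij.1 ij.2 - f n ij.1 ij.2| <= e.
  by apply: filter_forall => -[i j] /=; have /cvgrPdist_le/(_ _ e0) := fA i j.
apply: filterS => n fn; apply: le_mx_norm; first exact: ltW.
by move=> i j; rewrite !mxE; exact: (fn (i, j)).
Qed.

Lemma cvg_sumr (R : realType) (V : pseudoMetricNormedZmodType R) I (U : set_system I)
    {FU : Filter U} (J : finType) (f : I -> J -> V) (a : J -> V) :
  (forall j, f n j @[n --> U] --> a j) -> \sum_j f n j @[n --> U] --> \sum_j a j.
Proof.
move=> fa; elim: (index_enum J) => [|j r IH].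
  by rewrite big_nil; under eq_cvg do rewrite big_nil; exact: cvg_cst.
by rewrite big_cons; under eq_cvg do rewrite big_cons; exact: cvgD.
Qed.

Lemma cvg_affine_comb (R : realType) (V : normedModType R) I (U : set_system I)
    {FU : Filter U} (J : finType) (f : I -> J -> R) (a : J -> R) (y : J -> V) (b : V) :
  (forall j, f n j @[n --> U] --> a j) ->
  \sum_j f n j *: y j + (1 - \sum_j f n j) *: b @[n --> U] -->
  \sum_j a j *: y j + (1 - \sum_j a j) *: b.
Proof.
move=> fa.
apply: cvgD; first by apply: cvg_sumr => j; apply: cvgZ; [exact: fa|exact: cvg_cst].
by apply: cvgZ; [apply: cvgB; [exact: cvg_cst|exact: cvg_sumr]|exact: cvg_cst].
Qed.

Lemma cvg_div_dist1 (R : realType) I (U : set_system I) {FU : Filter U}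
    (f s : I -> R) (a t : R) : f n @[n --> U] --> a -> s n @[n --> U] --> t ->
  f n / (1 + `|s n - 1|) @[n --> U] --> a / (1 + `|t - 1|).
Proof.
move=> fa st; apply: cvgM; first exact: fa.
apply: cvgV; first by rewrite gt_eqF// ltr_wpDr.
apply: cvgD; first exact: cvg_cst.
by apply: cvg_norm; apply: cvgB; [exact: st|exact: cvg_cst].
Qed.

Lemma cvg_tent (R : realType) (V : normedModType R) I (U : set_system I)
    {FU : Filter U} (f : I -> V) (a c : V) (e : R) : f n @[n --> U] --> a ->
  (e - `|f n - c|) + `|e - `|f n - c| | @[n --> U] -->
  (e - `|a - c|) + `|e - `|a - c| |.
Proof.
move=> fa; have fc : `|f n - c| @[n --> U] --> `|a - c|.
  by apply: cvg_norm; apply: cvgB; [exact: fa|exact: cvg_cst].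
have efc : e - `|f n - c| @[n --> U] --> e - `|a - c|.
  by apply: cvgB; [exact: cvg_cst|exact: fc].
by apply: cvgD; [exact: efc|exact: cvg_norm].
Qed.

Lemma cvg_quot (R : realType) I (U : set_system I) {FU : Filter U}
    (f g : I -> R) (a b : R) : b != 0 ->
  f n @[n --> U] --> a -> g n @[n --> U] --> b -> f n / g n @[n --> U] --> a / b.
Proof. by move=> b0 fa gb; apply: cvgM; [exact: fa|exact: cvgV]. Qed.

Section Kakutani.
Context {R : realType} {V : normedModType R} (S : set V) (G : V -> set V).
Hypotheses (S0 : S !=set0) (cS : convex_set (S : set (convex_lmodType V)))
  (kS : compact S).
Hypothesis GS : forall x, S x ->
  [/\ G x !=set0, convex_set (G x : set (convex_lmodType V)) & G x `<=` S].
Hypothesis G_closed : forall x y, S x -> S y ->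
  (forall e, 0 < e -> exists x' y', [/\ S x', G x' y', `|x - x'| < e & `|y - y'| < e]) ->
  G x y.

(* The coefficients range over a cube rather than a simplex: the weight
   missing to reach 1 is put on the base point b, and the denominator keeps the
   coefficients in range without changing them when they sum to 1. *)
Let cube_conv N (y : 'I_N -> V) (b : V) (c : 'rV[R]_N) : V :=
  let m := 1 + `|\sum_i c 0 i - 1| in
  \sum_i (c 0 i / m) *: y i + (1 - \sum_i c 0 i / m) *: b.

Let cube_conv_continuous N (y : 'I_N -> V) b (c : 'rV[R]_N) :
  cube_conv y b x @[x --> c] --> cube_conv y b c.
Proof.
have ec i : (x : 'rV[R]_N) 0 i @[x --> c] --> c 0 i by exact: coord_continuous.
apply: (@cvg_affine_comb R V 'rV[R]_N (nbhs c)) => i.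
apply: (@cvg_div_dist1 R 'rV[R]_N (nbhs c)); first exact: ec.
exact: (cvg_sumr ec).
Qed.

Let cube_conv_in N (y : 'I_N -> V) b c : (forall i, S (y i)) -> S b -> unit_cube c ->
  S (cube_conv y b c).
Proof.
move=> Sy Sb c01; rewrite /cube_conv; set m := 1 + _.
have m0 : 0 < m by rewrite ltr_wpDr.
apply: convex_set_subsum => // [i|].
  by have /andP[c0 _] := c01 i; rewrite divr_ge0// ltW.
rewrite -mulr_suml ler_pdivrMr// mul1r /m.
by have := ler_norm (\sum_i c 0 i - 1); lra.
Qed.

(** Values [y i] in [G (c i)], chosen on an e-net, are averaged with a partition of unity
    subordinate to the e-balls. Brouwer's theorem is applied to the weights, so that x averages only
    values taken at net points within e of it. *)
Lemma approximate_fixed_point (e : R) : 0 < e ->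
  exists x, S x /\ exists N (t : 'I_N -> R) (c y : 'I_N -> V),
    [/\ forall i, 0 <= t i, \sum_i t i = 1, x = \sum_i t i *: y i,
      forall i, S (c i) /\ G (c i) (y i) & forall i, t i != 0 -> `|x - c i| < e].
Proof.
move=> e0; have [b Sb] := S0; have [N [c [Sc net]]] := compact_eps_net e0 kS.
have /choice[y Gy] : forall i, exists y, G (c i) y by move=> i; have [] := GS (Sc i).
have Sy i : S (y i) by have [_ _] := GS (Sc i); apply.
pose P := cube_conv y b.
(* Twice the positive part of e - |x - c i|. *)
pose phi x i := (e - `|x - c i|) + `|e - `|x - c i| |.
have phi0 x i : 0 <= phi x i
  by rewrite /phi; have := ler_norm (- (e - `|x - c i|)); rewrite normrN; lra.
have phi_gt0 x i : (phi x i != 0) = (`|x - c i| < e).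
  apply/idP/idP => [|xe]; last by rewrite gt_eqF// /phi ger0_norm; lra.
  by apply: contraNT; rewrite -leNgt /phi => xe; rewrite ler0_norm; [apply/eqP|]; lra.
have sum_phi x : S x -> 0 < \sum_i phi x i.
  move=> Sx; have [i xi] := net _ Sx; rewrite (bigD1 i)//= ltr_wpDr ?sumr_ge0//.
  by rewrite lt_def phi0 phi_gt0 xi.
pose g (t : 'rV[R]_N) : 'rV[R]_N := \row_i (phi (P t) i / \sum_j phi (P t) j).
have [t tcube|t tcube|t tcube gt] := @brouwer_cube R N g.
- have SP := sum_phi _ (cube_conv_in Sy Sb tcube).
  have phic i : phi (P x) i @[x --> t] --> phi (P t) i.
    by apply: (@cvg_tent R V 'rV[R]_N (nbhs t) _ P); exact: cube_conv_continuous.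
  apply: (@cvg_mx R 'rV[R]_N (nbhs t)) => i j; rewrite mxE.
  rewrite (_ : (fun x => g x i j) = fun x => phi (P x) j / \sum_k phi (P x) k); last first.
    by apply/funext => x; rewrite mxE.
  by apply: (@cvg_quot R 'rV[R]_N (nbhs t)); [rewrite gt_eqF|exact: phic|exact: (cvg_sumr phic)].
- have SP := sum_phi _ (cube_conv_in Sy Sb tcube).
  move=> i; rewrite mxE divr_ge0 ?(ltW SP)//= ler_pdivrMr// mul1r.
  by rewrite (bigD1 i)//= lerDl sumr_ge0.
have SPt := cube_conv_in Sy Sb tcube; have SP := sum_phi _ SPt.
have tE i : t 0 i = phi (P t) i / \sum_j phi (P t) j by rewrite -{1}gt mxE.
(* The weights of a fixed point are normalised, so [cube_conv] reduces to the plain combination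
   without [b]. *)
have t1 : \sum_i t 0 i = 1.
  by under eq_bigr do rewrite tE; rewrite -mulr_suml divff// gt_eqF.
have PtE : P t = \sum_i t 0 i *: y i.
  rewrite /P /cube_conv t1 subrr normr0 addr0; under eq_bigr do rewrite divr1.
  by rewrite -[X in _ + X]/(_ *: _); under [X in 1 - X]eq_bigr do rewrite divr1;
    rewrite t1 subrr scale0r addr0.
exists (P t); split => //; exists N, (fun i => t 0 i), c, y; split=> //.
- by move=> i; have /andP[] := tcube i.
- by move=> i; rewrite tE mulf_eq0 negb_or phi_gt0 => /andP[].
Qed.

(** Otherwise there are x_n -> x and y_n in G(x_n) at distance at least e from G(x); a limit of the
    y_n exists by compactness and lies in G(x) by closedness of the graph, a contradiction. *)
Lemma upper_hemicontinuous x (e : R) : S x -> 0 < e ->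
  exists2 d, 0 < d & forall x' y, S x' -> `|x - x'| < d -> G x' y ->
    exists2 z, G x z & `|y - z| < e.
Proof.
move=> Sx e0; apply: contrapT => /forall2NP h.
have /choice[xy xyP] : forall n : nat, exists xy : V * V,
    [/\ S xy.1, `|x - xy.1| < n.+1%:R^-1, G xy.1 xy.2 &
      forall z, G x z -> e <= `|xy.2 - z| ].
  move=> n; have [|/existsNP[x' /existsNP[y]]] := h n.+1%:R^-1.
    by rewrite invr_gt0 ltr0n.
  move=> /not_implyP[Sx' /not_implyP[xx' /not_implyP[Gy /forall2NP yz]]].
  exists (x', y); split => // z Gz; rewrite leNgt; apply/negP => ze.
  by case: (yz z).
have Sy n : S (xy n).2 by have [/GS[_ _ GxS] _ /GxS] := xyP n.
have [U [ultraU ooU]] := ultraFilterLemma (F := \oo) _.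
have PU : ProperFilter U by exact: ultra_proper.
have [y Sy' yU] := ultra_cvg ultraU kS Sy.
have Gxy : G x y.
  apply: G_closed => // d d0.
  have /cvgrPdist_lt/(_ _ d0) yd := yU.
  have xd : \forall n \near U, n.+1%:R^-1 < d :> R.
    apply: ooU; have /cvgrPdist_lt/(_ _ d0) := @cvg_harmonic R.
    by apply: filterS => n; rewrite sub0r normrN ger0_norm// invr_ge0.
  have [n [yn xn]] := filter_ex (filterI yd xd).
  exists (xy n).1, (xy n).2; have [? /lt_trans xxn ? _] := xyP n; split => //.
  exact: xxn.
have /cvgrPdist_lt/(_ _ e0) ye := yU.
have [n yn] := filter_ex ye; have [_ _ _ /(_ _ Gxy)] := xyP n.
by rewrite leNgt distrC yn.
Qed.

(** An approximate fixed point is an average of points [y i]. Near a limit x, each [y i] of nonzero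
    weight is close to some [z i] in [G x], and the same average of the [z i] lies in [G x] by
    convexity and close to x. *)
Theorem kakutani_fan_glicksberg : exists2 x, S x & G x x.
Proof.
have n0 (n : nat) : 0 < n.+1%:R^-1 :> R by rewrite invr_gt0 ltr0n.
have /choice[u uP] := fun n => approximate_fixed_point (n0 n).
have [U [ultraU ooU]] := ultraFilterLemma (F := \oo) _.
have PU : ProperFilter U by exact: ultra_proper.
have [x Sx ux] := ultra_cvg ultraU kS (fun n => (uP n).1).
exists x => //; apply: G_closed => // e e0; exists x.
have e2 : 0 < e / 2 by rewrite divr_gt0.
have [d d0 near_x] := upper_hemicontinuous Sx e2.
(* Half of [d] for each of x - u_n and u_n - c_i keeps [c i] within [d] of x; the bound e / 2 serves
   the final triangle inequality. *)
pose m := Num.min (d / 2) (e / 2).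
have m0 : 0 < m by rewrite lt_min e2 divr_gt0.
have /cvgrPdist_lt/(_ _ m0) um := ux.
have inv_m : \forall n \near U, n.+1%:R^-1 < m :> R.
  apply: ooU; have /cvgrPdist_lt/(_ _ m0) := @cvg_harmonic R.
  by apply: filterS => n; rewrite sub0r normrN ger0_norm// invr_ge0.
have [n [un nm]] := filter_ex (filterI um inv_m).
have [Sun [N [t [c [y [t0 t1 unE Gcy close]]]]]] := uP n.
have [Gx0 cGx _] := GS Sx; have [z0 Gz0] := Gx0.
have /choice[z zP] : forall i, exists z, G x z /\ (t i != 0 -> `|y i - z| < e / 2).
  move=> i; have [Sci Gyi] := Gcy i; have [_|ti] := eqVneq (t i) 0; first by exists z0.
  have [|z Gz yz] := near_x (c i) (y i) Sci _ Gyi; last by exists z.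
  rewrite -(subrKA (u n)) (le_lt_trans (ler_normD _ _))//.
  move: un nm => /=; rewrite !lt_min => /andP[un _] /andP[nd _].
  by rewrite (splitr d) ltrD// (lt_trans (close i ti)).
exists (\sum_i t i *: z i); split => //.
- by apply: convex_set_sum => // i; have [] := zP i.
- by rewrite subrr normr0.
rewrite -(subrKA (u n)) (le_lt_trans (ler_normD _ _))// (splitr e) ltr_leD//.
  by move: un; rewrite /= lt_min => /andP[].
rewrite unE -sumrB (le_trans (ler_norm_sum _ _ _))//.
rewrite (_ : e / 2 = \sum_i t i * (e / 2)); last by rewrite -mulr_suml t1 mul1r.
apply: ler_sum => i _.
rewrite -scalerBr normrZ (ger0_norm (t0 i)).
have [->|ti] := eqVneq (t i) 0; first by rewrite !mul0r.
by apply: ler_wpM2l => //; apply: ltW; exact: (zP i).2.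
Qed.

End Kakutani.

(** * Young's estimate *)

Section EuclideanNorm.
Context {R : realType} {p q : nat}.
Implicit Types A B : 'M[R]_(p, q).

Lemma enormN A : enorm (- A) = enorm A.
Proof. by rewrite -scaleN1r enormZ normrN normr1 mul1r. Qed.

Lemma enormB A B : enorm (A - B) = enorm (B - A).
Proof. by rewrite -enormN opprB. Qed.

Lemma ler_enorm_sum (I : Type) (s : seq I) (F : I -> 'M[R]_(p, q)) :
  enorm (\sum_(i <- s) F i) <= \sum_(i <- s) enorm (F i).
Proof.
elim: s => [|i s IH]; first by rewrite !big_nil enorm0.
by rewrite !big_cons (le_trans (ler_enormD _ _))// lerD2l.
Qed.

Lemma le_entry_enorm A i j : `|A i j| <= enorm A.
Proof.
rewrite -(@ler_pXn2r _ 2)// ?nnegrE ?enorm_ge0// sqr_enorm /edot.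
rewrite (bigD1 i)//= (bigD1 j)//= real_normK ?num_real// expr2 -addrA lerDl.
rewrite addr_ge0// sumr_ge0// => k _; first by rewrite -expr2 sqr_ge0.
by apply: sumr_ge0 => m _; rewrite -expr2 sqr_ge0.
Qed.

Lemma le_norm_enorm A : `|A| <= enorm A.
Proof. by apply: le_mx_norm => [|i j]; [exact: enorm_ge0|exact: le_entry_enorm]. Qed.

Lemma cvg_enorm I (U : set_system I) {FU : Filter U} (f : I -> 'M[R]_(p, q)) A :
  f n @[n --> U] --> A -> enorm (f n) @[n --> U] --> enorm A.
Proof.
move=> fA.
have ff : edot (f n) (f n) @[n --> U] --> edot A A.
  apply: cvg_sumr => i; apply: cvg_sumr => j.
  by apply: cvgM; exact: cvg_mx_entry.
apply: (@cvg_comp _ _ _ (fun n => edot (f n) (f n)) Num.sqrt _ _ _ ff).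
exact: sqrt_continuous.
Qed.

Lemma sqr_edot_le A B : edot A B ^+ 2 <= edot A A * edot B B.
Proof.
rewrite -!sqr_enorm -exprMn -(real_normK (num_real (edot A B))).
rewrite ler_pXn2r ?nnegrE// ?mulr_ge0 ?enorm_ge0// ler_norml edot_le_enorm andbT.
rewrite lerNl -mulN1r -edotZl (le_trans (edot_le_enorm _ _))//.
by rewrite scaleN1r enormN.
Qed.

End EuclideanNorm.

Lemma enorm_mulmx_le (R : realType) (p q : nat) (A : 'M[R]_(p, q)) (v : 'cV[R]_q) :
  enorm (A *m v) <= enorm A * enorm v.
Proof.
rewrite -(@ler_pXn2r _ 2)// ?nnegrE ?mulr_ge0 ?enorm_ge0//.
rewrite exprMn !sqr_enorm [edot A A]/edot mulr_suml; apply: ler_sum => i _.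
rewrite big_ord1 -expr2.
have -> : (A *m v) i 0 = edot (row i A)^T v.
  by rewrite mxE /edot; apply: eq_bigr => j _; rewrite big_ord1 !mxE.
apply: (le_trans (sqr_edot_le _ _)); rewrite ler_wpM2r ?edot_ge0//.
by rewrite /edot le_eqVlt; apply/orP; left; apply/eqP; apply: eq_bigr => j _; rewrite big_ord1 !mxE.
Qed.

Lemma cvg_mulmxl (R : realType) (p q r : nat) I (U : set_system I) {FU : Filter U}
    (f : I -> 'M[R]_(p, q)) (A : 'M[R]_(p, q)) (v : 'M[R]_(q, r)) :
  f n @[n --> U] --> A -> f n *m v @[n --> U] --> A *m v.
Proof.
move=> fA; apply: cvg_mx => i j; rewrite mxE.
rewrite (_ : (fun n => (f n *m v) i j) = fun n => \sum_k f n i k * v k j); last first.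
  by apply/funext => n; rewrite mxE.
by apply: cvg_sumr => k; apply: cvgM; [exact: cvg_mx_entry|exact: cvg_cst].
Qed.

(** * Riemann sums under dyadic refinement *)

Section Young.
Context {R : realType} {T : {posnum R}} {l d : nat}.
Implicit Types (f : time T -> 'M[R]_(l, d)) (w : time T -> 'cV[R]_d) (u : nat -> time T).

Definition riemann_sum f w u n : 'cV[R]_l :=
  \sum_(k < n) f (u k) *m (w (u k.+1) - w (u k)).

Lemma midpoint_itv (s t : time T) : 0 <= (time_val s + time_val t) / 2 <= T%:num.
Proof. by have := time_val_itv s; have := time_val_itv t; lra. Qed.

Definition midpoint s t : time T := to_time (midpoint_itv s t).

Lemma time_val_midpoint s t : time_val (midpoint s t) = (time_val s + time_val t) / 2.
Proof. by []. Qed.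

Definition halve u (k : nat) : time T :=
  if odd k then midpoint (u k./2) (u k./2.+1) else u k./2.

Lemma halve_double u k : halve u k.*2 = u k.
Proof. by rewrite /halve odd_double doubleK. Qed.

Lemma halve_doubleS u k : halve u k.*2.+1 = midpoint (u k) (u k.+1).
Proof. by rewrite /halve /= odd_double /= uphalf_double. Qed.

Definition mesh_lt u n (delta : R) :=
  forall k, (k < n)%N -> time_val (u k.+1) - time_val (u k) < delta.

Lemma halve_dissection t n u : dissection t n u -> dissection t n.*2 (halve u).
Proof.
move=> [u0 un u_incr]; split=> [||k kn].
- by rewrite -(halve_double u 0) in u0.
- by rewrite halve_double.
- have := u_incr k./2; rewrite ltn_half_double kn => /(_ isT).
  rewrite -{3 4}[k]odd_double_half; case: (odd k) => /= h; rewrite ?add1n ?add0n.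
    by rewrite -doubleS halve_double halve_doubleS time_val_midpoint; lra.
  by rewrite halve_double halve_doubleS time_val_midpoint; lra.
Qed.

Lemma halve_mesh u n delta : mesh_lt u n delta -> mesh_lt (halve u) n.*2 (delta / 2).
Proof.
move=> u_lt k kn.
have := u_lt k./2; rewrite ltn_half_double kn => /(_ isT).
rewrite -{3 4}[k]odd_double_half; case: (odd k) => /= h; rewrite ?add1n ?add0n.
  by rewrite -doubleS halve_double halve_doubleS time_val_midpoint; lra.
by rewrite halve_double halve_doubleS time_val_midpoint; lra.
Qed.

Lemma sum_double (V : zmodType) (F : nat -> V) n :
  \sum_(k < n.*2) F k = \sum_(k < n) (F k.*2 + F k.*2.+1).
Proof.
elim: n => [|n IH]; first by rewrite !big_ord0.
by rewrite doubleS !big_ord_recr /= IH addrA.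
Qed.

Lemma riemann_sum_halve f w u n :
  riemann_sum f w (halve u) n.*2 - riemann_sum f w u n =
  \sum_(k < n) (f (midpoint (u k) (u k.+1)) - f (u k)) *m
     (w (u k.+1) - w (midpoint (u k) (u k.+1))).
Proof.
rewrite /riemann_sum.
rewrite (sum_double (fun k => f (halve u k) *m (w (halve u k.+1) - w (halve u k)))) -sumrB.
 apply: eq_bigr => k _.
rewrite halve_double halve_doubleS -doubleS halve_double.
set m := midpoint _ _.
rewrite [RHS]mulmxBl addrAC -mulmxBr addrC.
rewrite (_ : w m - w (u k) - _ = - (w (u k.+1) - w m)) ?mulmxN//.
by rewrite !opprB addrA subrK.
Qed.

Lemma dissection_sum t n u : dissection t n u ->
  \sum_(k < n) (time_val (u k.+1) - time_val (u k)) = time_val t.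
Proof.
move=> [u0 <- _]; rewrite -(big_mkord predT (fun k => time_val (u k.+1) - time_val (u k))).
by rewrite telescope_sumr// u0 subr0.
Qed.

Section Estimate.
Context {alpha beta r W : R} (ab : 1 < alpha + beta) (r0 : 0 <= r) (W0 : 0 <= W).

Definition holder_bound p q (c a : R) (g : time T -> 'M[R]_(p, q)) :=
  forall s t, time_val s < time_val t ->
    enorm (g s - g t) <= c * (time_val t - time_val s) `^ a.

(** A term over a step h is at most r W (h/2)^(alpha+beta), hence at most r W delta^(alpha+beta-1)
    h, and the steps add up to at most T. *)
Lemma riemann_sum_halve_le f w t n u delta :
  holder_bound r alpha f -> holder_bound W beta w ->
  dissection t n u -> mesh_lt u n delta ->
  enorm (riemann_sum f w (halve u) n.*2 - riemann_sum f w u n) <=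
    r * W * T%:num * delta `^ (alpha + beta - 1).
Proof.
move=> fr wW dis mesh; rewrite riemann_sum_halve (le_trans (ler_enorm_sum _ _))//.
have [_ _ u_incr] := dis.
pose h k := time_val (u k.+1) - time_val (u k).
apply: (@le_trans _ _ (\sum_(k < n) r * W * delta `^ (alpha + beta - 1) * h k)).
  apply: ler_sum => k _; have hk : 0 < h k by rewrite subr_gt0 u_incr.
  have hk2 : 0 < h k / 2 by rewrite divr_gt0.
  apply: (le_trans (enorm_mulmx_le _ _)).
  set m := midpoint _ _.
  have mu : time_val m - time_val (u k) = h k / 2.
    by rewrite time_val_midpoint /h; lra.
  have um : time_val (u k.+1) - time_val m = h k / 2.
    by rewrite time_val_midpoint /h; lra.
  have f_le : enorm (f m - f (u k)) <= r * (h k / 2) `^ alpha.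
    by rewrite enormB -mu fr// -subr_gt0 mu.
  have w_le : enorm (w (u k.+1) - w m) <= W * (h k / 2) `^ beta.
    by rewrite enormB -um wW// -subr_gt0 um.
  apply: (le_trans (ler_pM (enorm_ge0 _) (enorm_ge0 _) f_le w_le)).
  rewrite mulrACA -[leRHS]mulrA ler_wpM2l ?mulr_ge0//.
  rewrite -powRD; last by rewrite (gt_eqF hk2) implybT.
  rewrite (_ : alpha + beta = (alpha + beta - 1) + 1); last by rewrite subrK.
  rewrite powRD ?(gt_eqF hk2) ?implybT// powRr1 ?(ltW hk2)//.
  rewrite addrK ler_pM ?powR_ge0 ?(ltW hk2)//.
    rewrite ge0_ler_powR ?nnegrE ?(ltW hk2) ?subr_ge0 ?(ltW ab)//.
      by rewrite (le_trans (ltW hk))// ltW// mesh.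
    by rewrite (@le_trans _ _ (h k))// ?ltW ?mesh//; lra.
  by lra.
rewrite -mulr_sumr (dissection_sum dis) -!mulrA !ler_wpM2l// mulrC.
by rewrite ler_wpM2r ?powR_ge0//; have /andP[] := time_val_itv t.
Qed.

Let q : R := 2^-1 `^ (alpha + beta - 1).

Let q_lt1 : q < 1.
Proof.
rewrite (@lt_le_trans _ _ (1 `^ (alpha + beta - 1)))//; last by rewrite powR1.
rewrite gt0_ltr_powR ?nnegrE ?subr_gt0//.
by rewrite invf_lt1// ltr1n.
Qed.

Definition young_constant : R := r * W * T%:num / (1 - q).

Lemma young_constant_ge0 : 0 <= young_constant.
Proof. by rewrite divr_ge0 ?mulr_ge0// subr_ge0 ltW. Qed.

(* The errors of the successive halvings form a geometric series of ratio
   2 ^ (1 - alpha - beta). *)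
Lemma refinement_le f w t n u delta m : 0 < delta ->
  holder_bound r alpha f -> holder_bound W beta w ->
  dissection t n u -> mesh_lt u n delta ->
  exists n' u', [/\ dissection t n' u', mesh_lt u' n' (delta / 2 ^+ m) &
    enorm (riemann_sum f w u' n' - riemann_sum f w u n) <=
      young_constant * delta `^ (alpha + beta - 1)].
Proof.
move=> + fr wW; elim: m n u delta => [n u delta d0 dis mesh|m IH n u delta d0 dis mesh].
  exists n, u; split=> //; first by rewrite expr0 divr1.
  by rewrite subrr enorm0 mulr_ge0 ?powR_ge0// young_constant_ge0.
have [|n' [u' [dis' mesh' le']]] :=
  IH _ _ _ _ (halve_dissection dis) (halve_mesh mesh); first by rewrite divr_gt0.
exists n', u'; split=> //.
  by move: mesh'; rewrite exprS invfM mulrA.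
have le1 := riemann_sum_halve_le fr wW dis mesh.
rewrite -(subrKA (riemann_sum f w (halve u) n.*2)).
apply: (le_trans (ler_enormD _ _)); apply: (le_trans (lerD le' le1)).
(* The constant K satisfies K q + r W T = K, and halving the mesh bound produces the factor q. *)
rewrite (_ : r * W * T%:num = young_constant * (1 - q)); last first.
  by rewrite /young_constant divfK// gt_eqF// subr_gt0.
rewrite powRM ?invr_ge0 ?(ltW d0)// -/q mulrCA.
by rewrite le_eqVlt; apply/orP; left; apply/eqP; ring.
Qed.

(** Refine until the mesh passes the threshold for e in the definition of the integral, then let e
    vanish. The bound depends on f only through r. *)
Lemma riemann_sum_young_le f w t I n u delta : 0 < delta ->
  holder_bound r alpha f -> holder_bound W beta w ->
  is_young_integral f w t I -> dissection t n u -> mesh_lt u n delta ->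
  enorm (riemann_sum f w u n - I) <= young_constant * delta `^ (alpha + beta - 1).
Proof.
move=> d0 fr wW fI dis mesh; apply/ler_addgt0Pr => e e0.
have [d' d'0 fI'] := fI _ e0.
have [m md] : exists m : nat, delta / 2 ^+ m < d'.
  have half1 : `|2^-1 : R| < 1 by rewrite ger0_norm ?invr_ge0// invf_lt1// ltr1n.
  have /cvgrPdist_lt/(_ _ d'0)/filter_ex[m] := cvg_geometric delta half1.
  rewrite sub0r normrN /= => dm; exists m.
  by rewrite -exprVn (le_lt_trans (ler_norm _)).
have [n' [u' [dis' mesh' le']]] := refinement_le m d0 fr wW dis mesh.
have lt_e : enorm (riemann_sum f w u' n' - I) < e.
  by apply: fI' => // k kn; apply: lt_trans md; exact: mesh'.
rewrite -(subrKA (riemann_sum f w u' n')) (le_trans (ler_enormD _ _))// lerD//.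
  by rewrite enormB.
exact: ltW.
Qed.

(** For a fixed dissection the Riemann sums converge, and the uniform estimate survives in the
    limit; this also proves that the integral of the limit function exists. *)
Lemma young_integral_cvg J (U : set_system J) {FU : ProperFilter U}
    (f_ : J -> time T -> 'M[R]_(l, d)) f w t (I_ : J -> 'cV[R]_l) I :
  (forall n, holder_bound r alpha (f_ n)) -> holder_bound W beta w ->
  (forall s, f_ n s @[n --> U] --> f s) ->
  (forall n, is_young_integral (f_ n) w t (I_ n)) -> I_ n @[n --> U] --> I ->
  is_young_integral f w t I.
Proof.
move=> fr wW f_f fI I_I e e0.
(* Adding 1 makes K positive even if [young_constant] is 0; then [delta] is chosen with K delta^th =
   e / 2. *)
pose K := young_constant + 1.
have K0 : 0 < K by rewrite ltr_wpDl// young_constant_ge0.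
pose th := alpha + beta - 1; have th0 : 0 < th by rewrite subr_gt0.
pose delta := (e / 2 / K) `^ th^-1.
have d0 : 0 < delta by rewrite powR_gt0// !divr_gt0.
have dK : young_constant * delta `^ th < e.
  rewrite /delta -powRrM mulVf ?gt_eqF// powRr1; last by rewrite !divr_ge0// ltW.
  rewrite mulrA ltr_pdivrMr// /K; have := young_constant_ge0; nra.
exists delta => // n u dis mesh; apply: le_lt_trans dK.
have RS_cvg : riemann_sum (f_ m) w u n @[m --> U] --> riemann_sum f w u n.
  by apply: cvg_sumr => k; exact: cvg_mulmxl.
have RSI : riemann_sum (f_ m) w u n - I_ m @[m --> U] --> riemann_sum f w u n - I.
  exact: cvgB.
apply: (cvg_ler _ (cvg_enorm RSI) (cvg_cst _)) => m /=.
exact: (riemann_sum_young_le d0 (fr m) wW (fI m) dis mesh).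
Qed.

End Estimate.

End Young.

(** * The closed graph *)

Section Hausdorff.
Context {R : realType} {p q : nat}.
Implicit Types (A B : set 'M[R]_(p, q)) (a : 'M[R]_(p, q)).

Lemma hausdorff_dist_lt A B a (e : R) : A a -> (hausdorff_dist A B < e%:E)%E ->
  exists2 b, B b & enorm (a - b) < e.
Proof.
move=> Aa; rewrite /hausdorff_dist gt_max => /andP[AB _].
have : (ereal_inf [set (enorm (a - b))%:E | b in B] < e%:E)%E.
  by apply: le_lt_trans AB; apply: ereal_sup_ubound; exists a.
by move=> /ereal_inf_lt[_ [b Bb <-]]; rewrite lte_fin => abe; exists b.
Qed.

(** Each a_n has a nearly closest point b_n in B; a limit of the b_n in the compact B is also the
    limit of the a_n. *)
Lemma hausdorff_dist_cvg (U : set_system nat) (A_ : nat -> set 'M[R]_(p, q)) B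
    (a_ : nat -> 'M[R]_(p, q)) :
  UltraFilter U -> \oo `<=` U -> compact B -> B !=set0 -> (forall n, A_ n (a_ n)) ->
  hausdorff_dist (A_ n) B @[n --> U] --> (0 : \bar R) ->
  exists2 b, B b & a_ n @[n --> U] --> b.
Proof.
move=> ultraU ooU cB [b0 Bb0] Aa /fine_cvgP[AB_fin AB0].
have PU : ProperFilter U by exact: ultra_proper.
(* The slack 1/(n+1) avoids attainment of the infimum. Where the distance is not finite, [b0] is a
   default value; this eventually does not occur along [U]. *)
have /choice[b_ bP] : forall n, exists b, B b /\ (hausdorff_dist (A_ n) B \is a fin_num ->
    enorm (a_ n - b) < fine (hausdorff_dist (A_ n) B) + n.+1%:R^-1).
  move=> n; have [ABn|//] := boolP (hausdorff_dist (A_ n) B \is a fin_num); last by exists b0.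
  have [|b Bb ab] := @hausdorff_dist_lt (A_ n) B (a_ n)
    (fine (hausdorff_dist (A_ n) B) + n.+1%:R^-1) (Aa n); last by exists b.
  by rewrite EFinD fineK// lteDl// lte_fin invr_gt0.
have [b Bb bU] := ultra_cvg ultraU cB (fun n => (bP n).1).
exists b => //; apply/cvgrPdist_le => e e0.
have e3 : 0 < e / 3 by rewrite divr_gt0.
have /cvgrPdist_le/(_ _ e3) nb := bU.
have /cvgrPdist_le/(_ _ e3) nAB := AB0.
have ninv : \forall n \near U, n.+1%:R^-1 <= e / 3 :> R.
  apply: ooU; have /cvgrPdist_le/(_ _ e3) := @cvg_harmonic R.
  by apply: filterS => n; rewrite sub0r normrN ger0_norm// invr_ge0.
apply: filterS (filterI (filterI AB_fin nAB) (filterI nb ninv)).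
move=> n /= [[ABn ABe] [be ne]].
rewrite -(subrKA (b_ n)) (le_trans (ler_normD _ _))//.
have le1 := le_norm_enorm (a_ n - b_ n); have le2 := (bP n).2 ABn.
move: ABe; rewrite sub0r normrN => /(le_trans (ler_norm _)) /= le3.
have : `|b_ n - a_ n| <= e / 3 + e / 3.
  by rewrite distrC (le_trans le1)// (le_trans (ltW le2))// lerD.
by lra.
Qed.

End Hausdorff.

(** * Measurability and norm comparison for Hölder functions *)

Section HolderFunctions.
Context {R : realType} {T : {posnum R}} {p q : nat}.
Implicit Types f : time T -> 'M[R]_(p, q).

Lemma holder_bound_dist (c a : R) f s t : 0 <= c -> holder_bound c a f ->
  enorm (f s - f t) <= c * `|time_val s - time_val t| `^ a.
Proof.
move=> c0 fc; have [st|st|st] := ltgtP (time_val s) (time_val t).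
- by rewrite distrC gtr0_norm ?subr_gt0// fc.
- by rewrite gtr0_norm ?subr_gt0// enormB fc.
- have -> : s = t by exact: val_inj.
  by rewrite subrr enorm0 mulr_ge0// powR_ge0.
Qed.

Let clamp (y : R) : R := Num.max 0 (Num.min T%:num y).

Let clamp_itv y : 0 <= clamp y <= T%:num.
Proof. by rewrite /clamp le_max lexx/= ge_max ltW//= ge_min lexx. Qed.

Let clamp_dist y z : `|clamp y - clamp z| <= `|y - z|.
Proof.
by rewrite /clamp !(maxEle, minEle); repeat case: ifPn; rewrite -?ltNge => *;
  rewrite ?subrr ?normr0//; rewrite ler_norml; have := ler_norm (y - z);
  have := ler_norm (z - y); rewrite (distrC z y); lra.
Qed.

(** Composition with the 1-Lipschitz retraction [clamp] extends f to a continuous function on the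
    line, so the set in question is [0, T] intersected with a continuous preimage of a Borel set. *)
Lemma time_measurable_holder (c a : R) f : 0 <= c -> 0 < a -> holder_bound c a f ->
  time_measurable f.
Proof.
move=> c0 a0 fc i j U mU; pose g y := f (to_time (clamp_itv y)) i j.
have g_cont : continuous g.
  move=> y; apply/cvgrPdist_le => e e0.
  pose delta := (e / (c + 1)) `^ a^-1.
  have c1 : 0 < c + 1 by rewrite ltr_wpDl.
  have d0 : 0 < delta by rewrite powR_gt0// divr_gt0.
  have dc : c * delta `^ a <= e.
    rewrite /delta -powRrM mulVf ?gt_eqF// powRr1; last by rewrite divr_ge0// ltW.
    by rewrite mulrA ler_pdivrMr//; nra.
  near=> z; apply: le_trans dc.
  have -> : g y - g z = (f (to_time (clamp_itv y)) - f (to_time (clamp_itv z))) i j.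
    by rewrite !mxE.
  apply: (le_trans (le_entry_enorm _ _ _)).
  apply: (le_trans (holder_bound_dist _ _ c0 fc)); rewrite ler_wpM2l//.
  rewrite ge0_ler_powR ?nnegrE ?(ltW a0) ?(ltW d0)//.
  apply: (le_trans (clamp_dist _ _)); near: z.
  have /cvgrPdist_le/(_ _ d0) := @cvg_id _ (nbhs y).
  by [].
have -> : @time_val R T @` [set t | U (f t i j)] = `[0, T%:num]%classic `&` g @^-1` U.
  apply/seteqP; split => [_ [t Ut <-]|y [/=]].
    have t0T := time_val_itv t; split => /=; first by rewrite in_itv.
    rewrite /g (_ : to_time _ = t)//; apply: val_inj => /=.
    by rewrite /clamp min_r ?max_r//; case/andP: t0T.
  rewrite in_itv/= => y0T Uy; exists (to_time y0T) => //=.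
  move: Uy; rewrite /g (_ : to_time (clamp_itv y) = to_time y0T)//; apply: val_inj => /=.
  by rewrite /clamp min_r ?max_r//; case/andP: y0T.
apply: measurableI; first exact: measurable_itv.
rewrite -[X in measurable X]setTI.
by apply: (continuous_measurable_fun g_cont).
Unshelve. all: by end_near. Qed.

Lemma holder_space_normE (a : R) (f : holder_space T a p q) :
  `|f| = fine (sup_norm (@point_norm R p q) f) +
         fine (holder_seminorm (@point_dist R p q) a f).
Proof.
rewrite [LHS](_ : _ = holder_space_norm f)// /holder_space_norm holder_normE//.
exact: holder_seminorm_lty.
Qed.

Lemma enorm_le_holder_space_norm (a : R) (f : holder_space T a p q) t :
  enorm (f t) <= `|f|.
Proof.
have lty := holder_seminorm_lty f.
have : (sup_norm (@point_norm R p q) f <= (fine (sup_norm (@point_norm R p q) f))%:E)%E.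
  rewrite fineK// ge0_fin_numE; first exact: holder_sup_norm_fin lty.
  exact: sup_norm_ge0.
move=> /sup_norm_leP/(_ t) /le_trans; apply.
by rewrite holder_space_normE lerDl fine_ge0// holder_seminorm_ge0.
Qed.

Lemma holder_space_bound (a : R) (f : holder_space T a p q) : holder_bound `|f| a f.
Proof.
have lty := holder_seminorm_lty f.
have := lexx (holder_seminorm (@point_dist R p q) a f).
rewrite -{2}[holder_seminorm _ _ _]fineK; last by rewrite ge0_fin_numE// holder_seminorm_ge0.
move=> /holder_seminorm_leP h s t st; apply: (le_trans (h _ _ st)).
rewrite ler_wpM2r ?powR_ge0// holder_space_normE lerDr.
by rewrite fine_ge0// sup_norm_ge0.
Qed.

(** On [0, T], h^a <= T^(a - a') h^a'. This passes from convergence in the norm of the space to the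
    weaker norm of condition 1. *)
Lemma holder_norm_le (a' a : R) (f : holder_space T a p q) : a' < a ->
  (holder_norm a' f <= ((1 + T%:num `^ (a - a')) * `|f|)%:E)%E.
Proof.
move=> aa; rewrite /holder_norm mulrDl mul1r EFinD; apply: leeD.
  by apply/sup_norm_leP => t; exact: enorm_le_holder_space_norm.
apply/holder_seminorm_leP => s t st; apply: (le_trans (holder_space_bound _ st)).
have st0 : 0 < time_val t - time_val s by rewrite subr_gt0.
have -> : (time_val t - time_val s) `^ a =
    (time_val t - time_val s) `^ (a - a') * (time_val t - time_val s) `^ a'.
  by rewrite -powRD ?subrK// (gt_eqF st0) implybT.
rewrite mulrA ler_wpM2r ?powR_ge0// mulrC ler_wpM2r//.
rewrite ge0_ler_powR ?nnegrE ?subr_ge0 ?(ltW aa) ?(ltW st) ?(ltW st0)//.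
by have := time_val_itv s; have := time_val_itv t; lra.
Qed.

End HolderFunctions.

(* The selections of the values of F_ n are uniformly Hoelder, so they converge
   pointwise along an ultrafilter; the limit is again a selection, and Young's
   estimate passes to it the convergence of the integrals. *)
Lemma upper_limit_aumann_young (R : realType) (T : {posnum R}) (d e l : nat)
    (alpha beta r : R) (w : holder_space T beta d 1)
    (Phi : time T * 'cV[R]_e -> set 'M[R]_(l, d))
    (x_ : nat -> holder_space T alpha e 1) (x : holder_space T alpha e 1) t :
  0 < alpha -> 1 < alpha + beta -> (forall z, Pck (Phi z)) ->
  (forall z0, hausdorff_dist (Phi z) (Phi z0) @[z --> z0] --> (0 : \bar R)) ->
  x_ n @[n --> \oo] --> x ->
  upper_limit (fun n => aumann_young alpha r (superposition Phi (x_ n)) w t) `<=`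
    aumann_young alpha r (superposition Phi x) w t.
Proof.
move=> a0 ab Phi_ck Phi_cont x_x I [k [I_ [k_incr I_n I_I]]].
have /choice[f_ fP] : forall n, exists f, holder_selection alpha r
    (superposition Phi (x_ (k n))) f /\ is_young_integral f w t (I_ n).
  by move=> n; have [f ? ?] := I_n n; exists f.
have f_bound n : holder_bound r alpha (f_ n).
  by have [[_ _ /holder_seminorm_leP]] := fP n.
have r0 : 0 <= r.
  have [[_ _ /(le_trans (holder_seminorm_ge0 _))]] := fP 0%N.
  by rewrite lee_fin.
have [U [ultraU ooU]] := ultraFilterLemma (F := \oo) _.
have PU : ProperFilter U by exact: ultra_proper.
have k_oo : k n @[n --> U] --> \oo.
  apply/cvgnyPge => A; apply: ooU; exists A => // n /= An.
  apply: (leq_trans An); elim: n {An} => // n; move/leq_ltn_trans; apply.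
  exact: k_incr.
have x_k : x_ (k n) @[n --> U] --> x by apply: cvg_comp k_oo x_x.
have xk s : x_ (k n) s @[n --> U] --> x s.
  apply/cvgrPdist_le => eps eps0.
  have /cvgrPdist_le/(_ _ eps0) := x_k.
  apply: filterS => n; apply: le_trans.
  apply: (le_trans (le_norm_enorm _)).
  exact: (enorm_le_holder_space_norm (x - x_ (k n)) s).
(* The limit is chosen separately at each time; it stays in Phi(s, x(s)) by continuity of Phi and
   compactness of its values. *)
have /choice[f fl] : forall s, exists y, Phi (s, x s) y /\ f_ n s @[n --> U] --> y.
  move=> s; have [Phi0 _ Phi_compact] := Phi_ck (s, x s).
  have [||y] := @hausdorff_dist_cvg R l d U (fun n => Phi (s, x_ (k n) s)) _
      (fun n => f_ n s) ultraU ooU Phi_compact Phi0.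
  - by move=> n; have [[_ + _] _] := fP n; apply.
  - have sxk : (s, x_ (k n) s) @[n --> U] --> (s, x s).
      exact: (cvg_pair (@cvg_cst _ s nat U _) (xk s)).
    exact: cvg_comp sxk (Phi_cont (s, x s)).
  by exists y.
have f_hb : holder_bound r alpha f.
  move=> s s' ss'.
  have fss : f_ n s - f_ n s' @[n --> U] --> f s - f s'.
    by apply: cvgB; [exact: (fl s).2|exact: (fl s').2].
  apply: (cvg_ler _ (cvg_enorm fss) (cvg_cst _)) => n /=.
  exact: f_bound.
exists f; first split.
(* Measurability comes from the Hölder bound of the limit: a pointwise limit along an ultrafilter
   need not inherit it. *)
- exact: time_measurable_holder r0 a0 f_hb.
- by move=> s; exact: (fl s).1.
- exact/holder_seminorm_leP.
apply: (young_integral_cvg ab r0 (normr_ge0 w) f_bound (holder_space_bound w)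
  (fun s => (fl s).2) (fun n => (fP n).2)).
by apply: cvg_trans I_I; move=> V; exact: ooU.
Qed.

(** * Closedness of the graph of Gamma and the fixed point *)

Theorem theorem4p3 (R : realType) (T : {posnum R}) (d e l : nat)
  (d_gt0 : (0 < d)%N) (e_gt0 : (0 < e)%N) (l_gt0 : (0 < l)%N)
  (alpha beta : R) (alpha01 : 0 < alpha < 1) (beta01 : 0 < beta < 1)
  (alpha_beta : 1 < alpha + beta) (alpha_lt_beta : alpha < beta)
  (w : holder_space T beta d 1)
  (S : set (holder_space T alpha e 1))
  (S_neq0 : S !=set0)
  (S_convex : convex_set (S : set (convex_lmodType (holder_space T alpha e 1))))
  (S_compact : compact S)
  (Phi : time T * 'cV[R]_e -> set 'M[R]_(l, d))
  (Phi_ck : forall z, Pck (Phi z))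
  (Phi_continuous : forall z0,
    hausdorff_dist (Phi z) (Phi z0) @[z --> z0] --> (0 : \bar R))
  (Phi_bounded : exists2 M : R, 0 < M & forall x, S x ->
    holder_multifunction alpha (superposition Phi x) /\
    (holder_set_norm alpha (superposition Phi x) <= M%:E)%E)
  (r : R)
  (r_ge : (ereal_sup
    [set mine
       (steiner_constant (l * d)%N *
          holder_seminorm hausdorff_dist alpha (superposition Phi x))
       (holder_seminorm demyanov_dist alpha (superposition Phi x))
    | x in S] <= r%:E)%E) :
  let Phi_w := fun x : holder_space T alpha e 1 =>
    aumann_young alpha r (superposition Phi x) w in
  let B := [set Phi_w x | x in S] in
  forall (alpha' : R), 0 < alpha' < alpha ->
  forall Psi : (time T -> set 'cV[R]_l) -> set (holder_space T alpha e 1),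
  (forall F, B F -> Psi F !=set0) ->
  (forall (F_ : nat -> time T -> set 'cV[R]_l) (F : time T -> set 'cV[R]_l),
    (forall n, B (F_ n)) -> B F ->
    (forall t, upper_limit (fun n => F_ n t) `<=` F t) ->
    forall (psi_ : nat -> holder_space T alpha e 1) (psi : holder_space T alpha e 1),
    (forall n, Psi (F_ n) (psi_ n)) ->
    holder_norm alpha' (fun t => psi_ n t - psi t) @[n --> \oo] --> (0 : \bar R) ->
    Psi F psi) ->
  (forall F, B F ->
    [/\ convex_set (Psi F : set (convex_lmodType (holder_space T alpha e 1))),
        closed (Psi F) & Psi F `<=` S]) ->
  exists2 x, S x & Psi (Phi_w x) x.
Proof.
move=> Phi_w B alpha' /andP[_ a'a] Psi Psi0 Psi_closed PsiS.
have BPhi x : S x -> B (Phi_w x) by exists x.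
apply: (kakutani_fan_glicksberg S_neq0 S_convex S_compact (G := Psi \o Phi_w)).
  move=> x Sx; have [cvx _ sub] := PsiS _ (BPhi x Sx).
  by split => //; exact: Psi0 _ (BPhi x Sx).
move=> x y Sx Sy near_xy.
have /choice[xy xyP] : forall n : nat, exists xy : holder_space T alpha e 1 * holder_space T alpha e 1,
    [/\ S xy.1, Psi (Phi_w xy.1) xy.2, `|x - xy.1| < n.+1%:R^-1 & `|y - xy.2| < n.+1%:R^-1].
  move=> n; have [|x' [y' h]] := near_xy n.+1%:R^-1; first by rewrite invr_gt0.
  by exists (x', y').
have cvg_close (z_ : nat -> holder_space T alpha e 1) z :
    (forall n, `|z - z_ n| < n.+1%:R^-1) -> z_ n @[n --> \oo] --> z.
  move=> zz; apply/cvgrPdist_lt => eps eps0.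
  have /cvgrPdist_lt/(_ _ eps0) := @cvg_harmonic R.
  apply: filterS => n; rewrite sub0r normrN ger0_norm ?invr_ge0//.
  exact/lt_trans.
have x_cvg : (xy n).1 @[n --> \oo] --> x.
  by apply: cvg_close => n; have [_ _ xn _] := xyP n; exact: xn.
have y_cvg : (xy n).2 @[n --> \oo] --> y.
  by apply: cvg_close => n; have [_ _ _ yn] := xyP n; exact: yn.
apply: (Psi_closed (fun n => Phi_w (xy n).1) _ _ (BPhi x Sx) _ (fun n => (xy n).2)).
- by move=> n; have [Sx' _ _ _] := xyP n; exact: BPhi.
- have /andP[alpha0 _] := alpha01.
  move=> t; exact: (upper_limit_aumann_young alpha0 alpha_beta Phi_ck Phi_continuous x_cvg).
- by move=> n; have [] := xyP n.
have yy : `|(xy n).2 - y| @[n --> \oo] --> (0 : R).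
  rewrite -(@normr0 _ (holder_space T alpha e 1)) -(subrr y); apply: cvg_norm.
  by apply: cvgB; [exact: y_cvg|exact: cvg_cst].
(* The comparison constant of [holder_norm_le]: the alpha'-norm of y_n - y is squeezed between 0 and
   C times its alpha-norm. *)
pose C := 1 + T%:num `^ (alpha - alpha').
have Cyy : C * `|(xy n).2 - y| @[n --> \oo] --> (0 : R).
  by rewrite -(mulr0 C); apply: cvgM; [exact: cvg_cst|exact: yy].
apply: (@squeeze_cvge _ _ _ _ (fun=> 0%E) _ (fun n => (C * `|(xy n).2 - y|)%:E)).
- apply: nearW => n; apply/andP; split.
    by rewrite adde_ge0 ?sup_norm_ge0 ?holder_seminorm_ge0.
  exact: (holder_norm_le ((xy n).2 - y) a'a).
- exact: cvg_cst.
- by apply: cvg_EFin => //; apply: nearW.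
Qed.
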